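(* Let $G_0 \xleftarrow{\varphi_0} G_1 \xleftarrow{\varphi_1} G_2 \xleftarrow{\varphi_2}\cdots$ be a sequence of covers of graphs with inverse limit the 0-dimensional system $(X,f)$. The following are equivalent: (1) $(X,f)$ is uniquely ergodic; (2) for every infinite $\mathbf{N}\subseteq\mathbb{N}$ and every system of circuits $\mathcal{C}$ enumerated by $\mathbf{N}$ that expresses all ergodic measures, $\overline{\mathcal{C}}_\infty$ consists of a single element; (3) there exist an infinite $\mathbf{N}\subseteq\mathbb{N}$ and a system of circuits $\mathcal{C}$ enumerated by $\mathbf{N}$ that expresses all ergodic measures such that $\overline{\mathcal{C}}_\infty$ consists of a single element; (4) for every $m\in\mathbb{N}$, for all circuits $c_n\in\mathrm{Circ}(G_n)$ ($n\in\mathbb{N}$), $\xi_{n,m}(\tilde{c}_n)$ converges, as $n\to\infty$, uniformly with respect to the choice of the circuits to an element of $\Delta_m$; that is, there is $\nu_m\in\Delta_m$ such that for every $\epsilon>0$ there is $n_0>m$ with $d(\xi_{n,m}(\tilde{c}),\nu_m)<\epsilon$ for all $n\ge n_0$ and all $c\in\mathrm{Circ}(G_n)$.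
   Context: A graph is a pair $G=(V,E)$ with $V$ a finite set and $E \subseteq V\times V$ such that for each $v\in V$ there are edges $(u_1,v),(v,u_2)\in E$. A graph homomorphism $\varphi:(V_1,E_1)\to(V_2,E_2)$ is a map $\varphi:V_1\to V_2$ with $(\varphi\times\varphi)(E_1)\subseteq E_2$; for $e=(u,v)\in E_1$ write $\varphi(e)=(\varphi(u),\varphi(v))$. It is a cover if $(\varphi\times\varphi)(E_1)=E_2$ and $(u,v),(u,v')\in E_1$ implies $\varphi(v)=\varphi(v')$. In a sequence of covers, write $G_n=(V_n,E_n)$, $n\in\mathbb{N}=\{0,1,2,\dots\}$; each $\varphi_n:G_{n+1}\to G_n$ is a cover and $G_0=(\{0\},\{(0,0)\})$. For $m>n$, $\varphi_{m,n}:=\varphi_n\circ\cdots\circ\varphi_{m-1}$. The inverse limit $(X,f)$ is: $X=\{(x_0,x_1,\dots)\in\prod_i V_i : x_i=\varphi_i(x_{i+1})\ \forall i\}$ with the product topology, and $f:X\to X$ is the continuous surjection whose graph is $\{(x,y): (x_i,y_i)\in E_i\ \forall i\}$. (A 0-dimensional system is a compact metrizable 0-dimensional space with a continuous surjective self-map; each is topologically conjugate to such an inverse limit.) For $v\in V_n$, $U(v)=\{x\in X:x_n=v\}$; for $e=(u,v)\in E_n$, $U(e)=U(u)\cap f^{-1}(U(v))$. $\mathcal{P}_f$ is the set of $f$-invariant Borel probability measures on $X$. For a graph $G=(V,E)$, $\mathcal{P}(G)$ is the set of formal sums $\sum_{e\in E}a(e)e$ (in $\mathbb{R}^E$) with all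 $a(e)\ge0$, $\sum_e a(e)=1$, and, for every $v\in V$, $\sum_{(u,v)\in E}a((u,v))=\sum_{(v,u)\in E}a((v,u))$. Put $\Delta_n=\mathcal{P}(G_n)$; for $m>n$, $\xi_{m,n}:\Delta_m\to\Delta_n$ is $\xi_{m,n}(\sum a(e)e)=\sum a(e)\varphi_{m,n}(e)$; $\Delta_\infty=\{(x_0,x_1,\dots): x_i\in\Delta_i,\ \xi_{m,n}(x_m)=x_n\ \forall m>n\}$. $d$ is the Euclidean distance on $\Delta_m\subset\mathbb{R}^{E_m}$. For $\mu\in\mathcal{P}_f$, $\bar\mu=(\mu_0,\mu_1,\dots)\in\Delta_\infty$ with $\mu_n=\sum_{e\in E_n}\mu(U(e))e$. A circuit of $G$ is a closed walk $(v_0,\dots,v_l)$, $l\ge1$, $(v_i,v_{i+1})\in E$, $v_0=v_l$, with $v_0,\dots,v_{l-1}$ pairwise distinct, regarded as a subgraph $c$ with edge set $E(c)$ and period $\mathrm{Per}(c)=l$; $\mathrm{Circ}(G)$ is the set of all circuits. A circuit $c$ is identified with $\sum_{e\in E(c)}e$, and $\tilde{c}=(1/\mathrm{Per}(c))\,c\in\mathcal{P}(G)$. A system of circuits enumerated by $\mathbf{N}$ is a sequence $\mathcal{C}=\{\mathcal{C}_n\}_{n\in\mathbf{N}}$ with $\mathcal{C}_n\subseteq\mathrm{Circ}(G_n)$. It expresses $\mu$ if for all $n\in\mathbf{N}$, $\mu_n=\sum_{c\in\mathcal{C}_n}s(c)\tilde{c}$ for some $s(c)\ge0$ ($c\in\mathcal{C}_n$).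 For a sequence $x_n\in\Delta_n$ ($n\in\mathbf{N}$), $\lim_{n\to\infty}x_n$ exists and equals $(y_0,y_1,\dots)\in\Delta_\infty$ if for every $m\in\mathbb{N}$, $\xi_{n,m}(x_n)\to y_m$ as $n\to\infty$, $n\in\mathbf{N}$. $\overline{\mathcal{C}}_\infty\subseteq\Delta_\infty$ is the set of all limits $\lim_{n\to\infty}\tilde{c}_n$ over sequences $\{c_n\}_{n\in\mathbf{N}}$ with $c_n\in\mathcal{C}_n$ for all $n\in\mathbf{N}$ for which this limit exists. *)

(* Defs.v *)
From HB Require Import structures.
From mathcomp Require Import all_boot all_order all_algebra.
From mathcomp Require Import all_classical all_reals all_analysis.

Set Implicit Arguments.
Unset Strict Implicit.
Unset Printing Implicit Defensive.

Import Order.TTheory GRing.Theory Num.Theory.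
Local Open Scope classical_set_scope.
Local Open Scope ring_scope.

Record graph := Graph {
  vertex :> finType;
  edge : rel vertex;
  edge_in : forall v, exists u, edge u v;
  edge_out : forall v, exists u, edge v u }.

Definition gedge (G : graph) := {e : G * G | edge e.1 e.2}.

Definition map_edge (G1 G2 : graph) (phi : G1 -> G2) (e : G1 * G1) : G2 * G2 :=
  (phi e.1, phi e.2).

Definition is_cover (G1 G2 : graph) (phi : G1 -> G2) : Prop :=
  map_edge phi @` [set e | edge e.1 e.2] = [set e | edge e.1 e.2] /\
  forall u v v', edge u v -> edge u v' -> phi v = phi v'.

(* Since [G_0] has a single vertex, [edge_in] makes its only possible edge, the
   loop, present. *)
Record coverSeq := CoverSeq {
  cgraph :> nat -> graph;
  cproj : forall n, cgraph n.+1 -> cgraph n;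
  cprojP : forall n, is_cover (@cproj n);
  cgraph0 : #|cgraph 0| = 1%N }.

(* [cproj_iter S k n] is the composition [phi_{m,n}] with [m = k + n]. *)
Fixpoint cproj_iter (S : coverSeq) (k n : nat) : S (k + n)%N -> S n :=
  if k is k'.+1
  then fun v => cproj_iter (@cproj S (k' + n) (v : S (k' + n).+1))
  else fun v => v.

Section InverseLimit.
Variable S : coverSeq.

Definition limit_set : set (prod_topology (fun n => discrete_topology (S n))) :=
  [set x | forall n, x n = @cproj S n (x n.+1)].

Definition inverse_limit : Type := set_type limit_set.
HB.instance Definition _ := Topological.on inverse_limit.

Definition lcoord (x : inverse_limit) (n : nat) : S n := sval x n.

Lemma lcoordP (x : inverse_limit) n : lcoord x n = @cproj S n (lcoord x n.+1).
Proof. by case: x => x xP; exact: (set_mem xP n). Qed.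

Lemma lcoord_ext (x y : inverse_limit) : (forall n, lcoord x n = lcoord y n) -> x = y.
Proof. by move=> xy; apply/val_inj/functional_extensionality_dep. Qed.

Lemma mk_limit (x : forall n, S n) : (forall n, x n = @cproj S n (x n.+1)) ->
  exists y : inverse_limit, forall n, lcoord y n = x n.
Proof. by move=> xP; exists (exist _ (x : prod_topology _) (mem_set xP)). Qed.

Lemma cproj_edge n (u v : S n.+1) :
  edge u v -> edge (@cproj S n u) (@cproj S n v).
Proof.
move=> uv; have [imE _] := @cprojP S n.
have : (map_edge (@cproj S n) @` [set e | edge e.1 e.2]) (cproj u, cproj v).
  by exists (u, v).
by rewrite imE.
Qed.

Lemma cproj_surj n (v : S n) : exists u : S n.+1, v = @cproj S n u.
Proof.
have [imE _] := @cprojP S n; have [w vw] := edge_out v.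
have : [set e : S n * S n | edge e.1 e.2] (v, w) by [].
by rewrite -imE => -[[a b] _ [<- _]]; exists a.
Qed.

Lemma inverse_limit_nonempty : exists x : inverse_limit, True.
Proof.
have [v0 _] : exists v : S 0%N, True.
  by have /card_gt0P[v _] : (0 < #|S 0%N|)%N; [rewrite cgraph0|exists v].
pose x := fix x n : S n :=
  if n is n'.+1 then projT1 (cid (cproj_surj (x n'))) else v0.
have [|y _] := @mk_limit x; last by exists y.
by move=> n /=; case: cid.
Qed.

(* The library's measurable types are pointed. *)
HB.instance Definition _ :=
  isPointed.Build inverse_limit (projT1 (cid inverse_limit_nonempty)).

Lemma limit_map_exists (x : inverse_limit) :
  exists y : inverse_limit, forall n, edge (lcoord x n) (lcoord y n).
Proof.
pose v n := projT1 (cid (edge_out (lcoord x n))).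
have vP n : edge (lcoord x n) (v n) by rewrite /v; case: cid.
have eP n : edge (lcoord x n) (@cproj S n (v n.+1)).
  by rewrite lcoordP; exact/cproj_edge/vP.
have [|y yE] := @mk_limit (fun n => @cproj S n (v n.+1)).
  by move=> n; have [_ +] := @cprojP S n; apply; [exact: vP|exact: eP].
by exists y => n; rewrite yE.
Qed.

(* The choice is immaterial: [limit_mapP] shows that the image is unique. *)
Definition limit_map (x : inverse_limit) : inverse_limit :=
  projT1 (cid (limit_map_exists x)).

Lemma limit_mapP (x y : inverse_limit) :
  y = limit_map x <-> forall n, edge (lcoord x n) (lcoord y n).
Proof.
rewrite /limit_map; case: cid => z zP /=; split=> [->//|yP].
apply: lcoord_ext => n; rewrite lcoordP [in RHS]lcoordP.
by have [_ +] := @cprojP S n; apply; [exact: yP|exact: zP].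
Qed.

Definition cylinder n (v : S n) : set inverse_limit := [set x | lcoord x n = v].

Definition edge_cylinder n (e : gedge (S n)) : set inverse_limit :=
  cylinder (val e).1 `&` limit_map @^-1` cylinder (val e).2.

Definition borel_limit := g_sigma_algebraType (@open inverse_limit).

End InverseLimit.

Section Measures.
Variables (R : realType) (S : coverSeq).
Implicit Type mu : probability (borel_limit S) R.

Definition invariant_measure mu : Prop :=
  forall A : set (borel_limit S), measurable A ->
    mu (@limit_map S @^-1` A) = mu A.

Definition ergodic_measure mu : Prop := invariant_measure mu /\
  forall A : set (borel_limit S), measurable A ->
    @limit_map S @^-1` A = A -> mu A = 0%E \/ mu A = 1%E.

(* Measures in the library are total on sets; as Borel measures they are
   compared on measurable sets only. *)
Definition uniquely_ergodic : Prop :=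
  exists mu, invariant_measure mu /\
    forall nu : probability (borel_limit S) R, invariant_measure nu ->
      forall A : set (borel_limit S), measurable A -> nu A = mu A.

End Measures.

Definition flow_polytope (R : realType) (G : graph) : set {ffun gedge G -> R} :=
  [set a | [/\ forall e, 0 <= a e,
               \sum_e a e = 1 &
               forall v : G, \sum_(e | (val e).1 == v) a e
                           = \sum_(e | (val e).2 == v) a e]].

Definition eucl_dist (R : realType) (G : graph) (a b : {ffun gedge G -> R}) : R :=
  Num.sqrt (\sum_e (a e - b e) ^+ 2).

Definition push (R : realType) (G1 G2 : graph) (phi : G1 -> G2)
    (a : {ffun gedge G1 -> R}) : {ffun gedge G2 -> R} :=
  [ffun e' => \sum_(e | map_edge phi (val e) == val e') a e].

Section Limits.
Variables (R : realType) (S : coverSeq).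

(* [xi k n] is [xi_{m,n}] with [m = k + n]. *)
Definition xi (k n : nat) :
    {ffun gedge (S (k + n)%N) -> R} -> {ffun gedge (S n) -> R} :=
  push (@cproj_iter S k n).
Arguments xi : clear implicits.

Definition Delta_infty : set (forall n, {ffun gedge (S n) -> R}) :=
  [set x | (forall n, flow_polytope (x n)) /\
           forall k n, xi k n (x (k + n)%N) = x n].

Definition limit_along (N : set nat) (x y : forall n, {ffun gedge (S n) -> R}) :
    Prop :=
  forall m (eps : R), 0 < eps -> exists n0 : nat,
    forall k, N (k + m)%N -> (n0 <= k + m)%N ->
      eucl_dist (xi k m (x (k + m)%N)) (y m) < eps.

Definition measure_vec (mu : probability (borel_limit S) R) (n : nat) :
    {ffun gedge (S n) -> R} :=
  [ffun e => fine (mu (edge_cylinder e))].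

End Limits.
Arguments xi {R} S k n a.

Section Circuits.
Variable G : graph.

(* For [s = [:: v_0; ...; v_(l-1)]], the edges [(v_i, v_(i+1))], [v_l = v_0]. *)
Definition cycle_gedges (s : seq G) : {set gedge G} :=
  [set e | val e \in zip s (rot 1 s)].

(* A circuit, as a subgraph, is given by its set of edges. *)
Definition is_circuit (c : {set gedge G}) : Prop :=
  exists s : seq G,
    [/\ (0 < size s)%N, cycle (@edge G) s, uniq s & c = cycle_gedges s].

Definition Circ : {set {set gedge G}} := [set c | `[< is_circuit c >]].

Definition Per (c : {set gedge G}) : nat := #|c|.

Lemma Per_cycle_gedges (s : seq G) :
  cycle (@edge G) s -> uniq s -> Per (cycle_gedges s) = size s.
Proof.
move=> cs us; pose t := zip s (rot 1 s).
have st : size t = size s by rewrite size1_zip // size_rot.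
have ut : uniq t.
  apply: (@map_uniq _ _ fst); rewrite -/(unzip1 _) unzip1_zip ?size_rot//.
have et : all (fun e : G * G => edge e.1 e.2) t.
  rewrite /t; case: s cs {us st ut t} => [//|x s].
  rewrite rot1_cons /=; move: {2 4}x => y.
  by elim: s x => [|z s IH] x /= /andP[-> // /IH].
have -> : size s = size (pmap (insub : _ -> option (gedge G)) t).
  by rewrite size_pmap_sub -st; apply/esym/eqP; rewrite -all_count.
rewrite -(card_uniqP (pmap_sub_uniq (gedge G) ut)); apply: eq_card => e.
by rewrite inE mem_pmap_sub.
Qed.

End Circuits.

Definition circuit_vec (R : realType) (G : graph) (c : {set gedge G}) :
    {ffun gedge G -> R} :=
  [ffun e => (e \in c)%:R].

Definition circuit_tilde (R : realType) (G : graph) (c : {set gedge G}) :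
    {ffun gedge G -> R} :=
  (Per c)%:R^-1 *: circuit_vec R c.

Section Systems.
Variables (R : realType) (S : coverSeq).

(* A system enumerated by [N] is represented by a family over all of [nat]; the
   definitions below never use its members with index outside [N]. *)
Definition circuit_system (N : set nat) (C : forall n, {set {set gedge (S n)}}) :
    Prop :=
  forall n, N n -> C n \subset Circ (S n).

Definition expresses (N : set nat) (C : forall n, {set {set gedge (S n)}})
    (mu : probability (borel_limit S) R) : Prop :=
  forall n, N n -> exists s : {set gedge (S n)} -> R,
    (forall c, c \in C n -> 0 <= s c) /\
    measure_vec mu n = \sum_(c in C n) s c *: circuit_tilde R c.

Definition expresses_ergodic (N : set nat)
    (C : forall n, {set {set gedge (S n)}}) : Prop :=
  forall mu : probability (borel_limit S) R, ergodic_measure mu -> expresses N C mu.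

Definition limit_circuits (N : set nat) (C : forall n, {set {set gedge (S n)}}) :
    set (forall n, {ffun gedge (S n) -> R}) :=
  [set y | Delta_infty y /\
    exists c : forall n, {set gedge (S n)},
      (forall n, N n -> c n \in C n) /\
      limit_along N (fun n => circuit_tilde R (c n)) y].

End Systems.
Arguments expresses_ergodic R {S} N C.
Arguments limit_circuits R {S} N C _.

(* Main.v *)
From HB Require Import structures.
Require Import Defs.
From mathcomp Require Import all_boot all_order all_algebra.
From mathcomp Require Import all_classical all_reals all_analysis.
From mathcomp Require Import ring lra.

Set Implicit Arguments.
Unset Strict Implicit.
Unset Printing Implicit Defensive.

Import Order.TTheory GRing.Theory Num.Theory.
Import numFieldNormedType.Exports.
Local Open Scope classical_set_scope.
Local Open Scope ring_scope.

(** Invariant probability measures of the inverse limit correspond to the points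
of [Delta_infty]: a measure is determined by its values on cylinders, hence by
its vectors [measure_vec] ([measure_vec_inj]), and conversely a compatible
sequence of flows is the sequence of vectors of an invariant measure
([Delta_infty_measure]).  Unique ergodicity therefore means that [Delta_infty]
is a single point ([uniquely_ergodicP]).

A flow on a finite graph is a convex combination of normalised circuits
([flow_decomposition]).  If normalised circuits of high level all project close
to [nu] in level [m], then so do all flows of high level, and every point of
[Delta_infty] has [m]-th coordinate [nu] ([flow_uniform_limit]).  Conversely,
limits of flows along an ultrafilter lie in [Delta_infty] ([ultralimit_Delta]);
so, when [Delta_infty] is a point, circuits cannot stay away from it
([circuits_uniform_limit]).  This makes the first and the last condition
equivalent.

The systems of circuits are handled through extreme points of [Delta_infty].
The measure of an extreme point is ergodic, since conditioning it on an
invariant set of positive measure gives an invariant measure dominated by a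
multiple of it ([extreme_ergodic]).  If a system of circuits expresses an
extreme point [z], then [z] is a limit of circuits of the system
([extreme_limit_circuits]).  Indeed, reweighting the circuits expressing [z] by
the factor 1 + p - z_e, where p is a coordinate of the circuit and z_e the same
coordinate of [z], gives again a convex combination, at most twice [z]; in the
limit it must be equal to [z], and comparing the coordinate in question shows
that the variance of p tends to zero ([variance_ultralimit]).

So a unique limit [y] of circuits is equal to every extreme point.  A point of
[Delta_infty] farthest from [y] for a weighted Euclidean distance is extreme by
strict convexity ([farthest_extreme]), whence [Delta_infty] is reduced to [y]. *)

(** * Flows and circuits of a finite graph *)

Lemma sum_zip_rot (T : eqType) (R : nmodType) (s : seq T) (F : T -> R) :
  \sum_(p <- zip s (rot 1 s)) F p.1 = \sum_(p <- zip s (rot 1 s)) F p.2.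
Proof.
have st : size s = size (rot 1 s) by rewrite size_rot.
rewrite -(big_map fst xpredT F) -(big_map snd xpredT F).
rewrite -/(unzip1 _) -/(unzip2 _) unzip1_zip ?unzip2_zip ?st//.
by apply: perm_big; rewrite perm_sym perm_rot.
Qed.

Lemma rot1_fcycle (T : eqType) (f : T -> T) (s : seq T) :
  fcycle f s -> rot 1 s = map f s.
Proof.
case: s => // x s; rewrite rot1_cons [cycle _ _]/= -(belast_rcons x s x).
move: (rcons s x) => p; elim: p x => [//|z p IH] y /= /andP[/eqP <- yp].
by rewrite -IH.
Qed.

Section Circuits.
Variables (R : realType) (G : graph).
Implicit Types (a b : {ffun gedge G -> R}) (c D : {set gedge G}).

Definition balanced a : Prop :=
  forall v : G, \sum_(e | (val e).1 == v) a e = \sum_(e | (val e).2 == v) a e.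

(** Stated for a map [h] so as to serve for sources and for targets of edges. *)
Lemma sum_gedge_vertex (h : G * G -> G) (Q : pred G) a :
  \sum_(e : gedge G | Q (h (val e))) a e =
  \sum_(v | Q v) \sum_(e : gedge G | h (val e) == v) a e.
Proof.
rewrite (partition_big (fun e : gedge G => h (val e)) Q) //.
apply: eq_bigr => v Qv; apply: eq_bigl => e.
by case: (_ =P v) => [->|]; rewrite ?Qv ?andbF.
Qed.

Lemma balanced_sum a (Q : pred G) : balanced a ->
  \sum_(e | Q (val e).1) a e = \sum_(e | Q (val e).2) a e.
Proof.
move=> ab; rewrite (sum_gedge_vertex fst) (sum_gedge_vertex snd).
by apply: eq_bigr => v _; exact: ab.
Qed.

Lemma sum_cycle_gedges (s : seq G) (F : G * G -> R) : cycle (@edge G) s -> uniq s ->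
  \sum_(e in cycle_gedges s) F (val e) = \sum_(p <- zip s (rot 1 s)) F p.
Proof.
move=> cs us; pose t := zip s (rot 1 s).
have st : size t = size s by rewrite size1_zip // size_rot.
have ut : uniq t.
  by apply: (@map_uniq _ _ fst); rewrite -/(unzip1 _) unzip1_zip ?size_rot.
have et : all (fun e : G * G => edge e.1 e.2) t.
  rewrite /t; case: s cs {us st ut t} => [//|x s].
  rewrite rot1_cons /=; move: {2 4}x => y.
  by elim: s x => [|z s IH] x /= /andP[-> // /IH].
have tP p : p \in t -> edge p.1 p.2 by move/(allP et).
rewrite -/t -big_enum /= -(big_map (val : gedge G -> G * G) xpredT F).
apply: perm_big; apply: uniq_perm => //.
  by rewrite map_inj_uniq ?enum_uniq//; exact: val_inj.
move=> p; apply/mapP/idP => [[e + ->]|pt].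
  by rewrite mem_enum inE.
by exists (exist _ p (tP p pt)) => //; rewrite mem_enum inE.
Qed.

(** Along a cycle, the list of targets is a rotation of the list of sources, so each
vertex occurs equally often in both. *)
Lemma circuit_tilde_flow c : c \in Circ G -> flow_polytope (circuit_tilde R c).
Proof.
rewrite inE => /asboolP[s [s0 cs us ->]].
have P0 : (0 < Per (cycle_gedges s))%N by rewrite Per_cycle_gedges.
have sumE (F : G -> R) (f : G * G -> G) :
    \sum_(e : gedge G) circuit_tilde R (cycle_gedges s) e * F (f (val e)) =
    (Per (cycle_gedges s))%:R^-1 * \sum_(p <- zip s (rot 1 s)) F (f p).
  rewrite -(sum_cycle_gedges (fun p => F (f p))) // big_distrr /=.
  rewrite [RHS]big_mkcond /=; apply: eq_bigr => e _; rewrite !ffunE.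
  by case: ifP => _; rewrite /= ?scaler0 ?mul0r // /GRing.scale /= mulr1.
split.
- by move=> e; rewrite !ffunE mulr_ge0 // invr_ge0.
- rewrite -[RHS](mulVf (_ : (Per (cycle_gedges s))%:R != 0)) ?pnatr_eq0 -?lt0n //.
  transitivity (\sum_e circuit_tilde R (cycle_gedges s) e * 1).
    by apply: eq_bigr => e _; rewrite mulr1.
  rewrite (sumE (fun=> 1) fst) -(sum_cycle_gedges (fun=> 1)) //.
  by rewrite sumr_const.
- move=> v.
  have restr (f : G * G -> G) :
      \sum_(e : gedge G | f (val e) == v) circuit_tilde R (cycle_gedges s) e =
      \sum_(e : gedge G) circuit_tilde R (cycle_gedges s) e *
                         (f (val e) == v)%:R.
    rewrite big_mkcond; apply: eq_bigr => e _.
    by case: eqP; rewrite ?mulr1 ?mulr0.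
  rewrite !restr (sumE (fun w => (w == v)%:R) fst).
  rewrite (sumE (fun w => (w == v)%:R) snd); congr (_ * _).
  exact: (@sum_zip_rot _ _ s (fun w : G => (w == v)%:R : R)).
Qed.

(** Every vertex with an outgoing edge in [D] gets a successor along such an edge.
Iterating the successor function on the finite set of vertices ends in a cycle;
following vertices rather than edges makes this cycle simple. *)
Lemma exists_circuit_sub D : D != finset.set0 ->
  (forall e, e \in D -> exists2 e', e' \in D & (val e').1 = (val e).2) ->
  exists2 c, c \in Circ G & c \subset D.
Proof.
move=> /set0Pn[e0 e0D] Dout.
pose active v := [exists e : gedge G, (e \in D) && ((val e).1 == v)].
pose next v := if [pick e : gedge G | (e \in D) && ((val e).1 == v)] is Some e
               then (val e).2 else v.
have nextP v : active v ->
    exists e : gedge G, [/\ e \in D, val e = (v, next v) & active (next v)].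
  move=> /existsP[e1 e1P]; rewrite /next; case: pickP => [e|/(_ e1)]; last first.
    by rewrite e1P.
  move=> /andP[eD /eqP ev]; exists e; split=> //.
    by rewrite -ev; case: (val e).
  have [e' e'D e'E] := Dout _ eD; apply/existsP; exists e'.
  by rewrite e'D e'E eqxx.
have iterP v k : active v -> active (iter k next v).
  by move=> av; elim: k => //= k /nextP[e []].
have av0 : active (val e0).1 by apply/existsP; exists e0; rewrite e0D /=.
have /loopingP/(_ (fingraph.order next (val e0).1)) := looping_order next (val e0).1.
(* The orbit of the starting vertex may have a preperiod; [v] is past it. *)
move=> /trajectP[i ilt iE]; pose v := iter i next (val e0).1.
have vcycle : fcycle next (fingraph.orbit next v).
  apply/(orbitPcycle 3 0); exists (fingraph.order next (val e0).1 - i).-1.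
  by rewrite prednK ?subn_gt0// -iterD subnK // ltnW.
have orbA w : w \in fingraph.orbit next v -> active w.
  by rewrite -fconnect_orbit => /iter_findex <-; apply/iterP/iterP.
have edgeA w : active w -> edge w (next w).
  by move=> /nextP[e [_ eE _]]; move: (valP e); rewrite eE.
have ssize : (0 < size (fingraph.orbit next v))%N by rewrite size_orbit order_gt0.
have nextE p : p \in zip (fingraph.orbit next v) (rot 1 (fingraph.orbit next v)) ->
    active p.1 /\ p.2 = next p.1.
  rewrite (rot1_fcycle vcycle) -[X in zip X]map_id zip_map.
  by move=> /mapP[w /orbA wA ->].
exists (cycle_gedges (fingraph.orbit next v)); last first.
  apply/fintype.subsetP => e; rewrite inE => /nextE[/nextP[e' [e'D e'E _]] eE].
  suff -> : e = e' by [].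
  by apply: val_inj; rewrite e'E -eE; case: (val e).
rewrite inE; apply/asboolP; exists (fingraph.orbit next v); split=> //.
  apply: sub_in_cycle vcycle => [w w' /orbA wA _ /eqP <-|].
    exact: edgeA.
  exact/allP.
Qed.

Lemma exists_circuit (v : G) : exists c, c \in Circ G.
Proof.
have [w vw] := edge_out v.
case: (@exists_circuit_sub [set: gedge G]%SET) => [||c cG _]; last by exists c.
  by apply/set0Pn; exists (exist _ (v, w) vw); rewrite finset.in_setT.
move=> e _; have [w' ew] := edge_out (val e).2.
by exists (exist _ ((val e).2, w') ew); rewrite ?finset.in_setT.
Qed.

(** By induction on the size of the support: the support of a nonzero balanced
vector contains a circuit, because a vertex that is entered is also left, and
subtracting the largest possible multiple of this circuit empties an edge. *)
Lemma circulation_decomposition a : (forall e, 0 <= a e) -> balanced a ->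
  exists s : {set gedge G} -> R, (forall c, 0 <= s c) /\
    a = \sum_(c in Circ G) s c *: circuit_tilde R c.
Proof.
have [k] := ubnP #|[set e | a e != 0]%SET|; elim: k a => // k IH a ak a0 ab.
have [supp0|supp] := eqVneq [set e | a e != 0]%SET finset.set0.
  exists (fun=> 0); split => //; rewrite big1 => [|c _]; last by rewrite scale0r.
  apply/ffunP => e; rewrite ffunE; apply/eqP; apply: contraFT (finset.in_set0 e).
  by rewrite -supp0 inE.
have [e|c cG csub] := exists_circuit_sub supp.
  rewrite inE => ae.
  have : \sum_(e' | (val e').1 == (val e).2) a e' != 0.
    rewrite ab gt_eqF // (bigD1 e) //= ltr_pwDl ?sumr_ge0 //.
    by rewrite lt_neqAle eq_sym ae a0.
  apply: contra_neqP => /forallPNP noe; rewrite big1 // => e' /eqP e'e.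
  by apply/eqP; apply: contraPT e'e => e'0; apply: noe; rewrite inE.
have [e0 e0c] : exists e0, e0 \in c.
  move: cG; rewrite inE => /asboolP[s [s0 cs us cE]].
  by apply/card_gt0P; rewrite -/(Per c) cE Per_cycle_gedges.
pose em := [arg min_(e < e0 in c) a e]%O.
have [emc emP] : em \in c /\ forall e, e \in c -> a em <= a e.
  by rewrite /em; case: arg_minP.
have P0 : (Per c)%:R != 0 :> R.
  by rewrite pnatr_eq0 -lt0n; apply/card_gt0P; exists e0.
(* [em] is the edge emptied; [Per c] undoes the normalisation of the circuit. *)
pose t := a em * (Per c)%:R.
pose a' := a - t *: circuit_tilde R c.
have a'E e : a' e = a e - (e \in c)%:R * a em.
  by rewrite !ffunE /t /GRing.scale /= mulrA mulfK // mulrC.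
have [ct0 _ ctb] := circuit_tilde_flow cG.
case: (IH a') => [|||s [s0 a'sum]].
- rewrite -ltnS; apply: leq_trans ak; rewrite ltnS; apply: proper_card.
  apply/properP; split.
    apply/fintype.subsetP => e; rewrite !inE a'E; apply: contra_neq => ae.
    rewrite ae; case: (boolP (e \in c)) => [/(fintype.subsetP csub)|]; last by rewrite mul0r subr0.
    by rewrite inE ae eqxx.
  exists em; rewrite ?(fintype.subsetP csub) //.
  by rewrite inE a'E emc mul1r subrr eqxx.
- move=> e; rewrite a'E; case: (boolP (e \in c)) => ec.
    by rewrite mul1r subr_ge0 emP.
  by rewrite mul0r subr0.
- move=> v; rewrite /a'.
  under eq_bigr do rewrite !ffunE; under [RHS]eq_bigr do rewrite !ffunE.
  rewrite !sumrB ab; congr (_ - _); move: (ctb v).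
  under eq_bigr do rewrite !ffunE; under [in RHS]eq_bigr do rewrite !ffunE.
  by rewrite -!scaler_sumr => ->.
exists (fun c' => s c' + (c' == c)%:R * t); split.
  by move=> c'; rewrite addr_ge0 // mulr_ge0 // mulr_ge0.
under eq_bigr do rewrite scalerDl.
rewrite big_split /= -a'sum (bigD1 c) //= eqxx mul1r big1 => [|c' /andP[_ /negPf ->]].
  by rewrite addr0 subrK.
by rewrite mul0r scale0r.
Qed.

Lemma flow_decomposition a : flow_polytope a ->
  exists s : {set gedge G} -> R, (forall c, 0 <= s c) /\
    a = \sum_(c in Circ G) s c *: circuit_tilde R c.
Proof. by case=> a0 _ ab; exact: circulation_decomposition. Qed.

Lemma sum_weights (C : {set {set gedge G}}) (s : {set gedge G} -> R) a :
  C \subset Circ G -> flow_polytope a ->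
  a = \sum_(c in C) s c *: circuit_tilde R c -> \sum_(c in C) s c = 1.
Proof.
move=> CC [_ <- _] ->; under [RHS]eq_bigr do rewrite sum_ffunE.
rewrite exchange_big /=; apply: eq_bigr => c cC.
have [_ ct1 _] := circuit_tilde_flow (fintype.subsetP CC _ cC).
by under [RHS]eq_bigr do rewrite ffunE; rewrite -scaler_sumr ct1 /GRing.scale /= mulr1.
Qed.

Lemma flow_convex (I : finType) (P : pred I) (s : I -> R)
    (x : I -> {ffun gedge G -> R}) :
  (forall i, P i -> 0 <= s i) -> \sum_(i | P i) s i = 1 ->
  (forall i, P i -> flow_polytope (x i)) ->
  flow_polytope (\sum_(i | P i) s i *: x i).
Proof.
move=> s0 s1 xP.
have E (Q : pred (gedge G)) : \sum_(e | Q e) (\sum_(i | P i) s i *: x i) e =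
     \sum_(i | P i) s i * \sum_(e | Q e) x i e.
  under eq_bigr do rewrite sum_ffunE.
  rewrite exchange_big /=; apply: eq_bigr => i Pi.
  by rewrite big_distrr; apply: eq_bigr => e _; rewrite ffunE.
split.
- move=> e; rewrite sum_ffunE; apply: sumr_ge0 => i Pi; rewrite ffunE.
  by have [x0 _ _] := xP i Pi; rewrite mulr_ge0 // s0.
- rewrite E -s1; apply: eq_bigr => i Pi.
  by have [_ -> _] := xP i Pi; rewrite mulr1.
- by move=> v; rewrite !E; apply: eq_bigr => i Pi; have [_ _ ->] := xP i Pi.
Qed.

Lemma flow_le1 a e : flow_polytope a -> 0 <= a e <= 1.
Proof.
move=> [a0 <- _]; rewrite a0 (bigD1 e) //= lerDl.
by apply: sumr_ge0 => *; exact: a0.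
Qed.

End Circuits.

(** * Points of the inverse limit through a given vertex or edge *)

Lemma dependent_choice (I : Type) (T : I -> Type) (P : forall i, T i -> Prop) :
  (forall i, exists x, P i x) -> exists f : forall i, T i, forall i, P i (f i).
Proof. by move=> /(_ _)/cid PT; exists (fun i => projT1 (PT i)) => i; case: PT. Qed.

Section Threads.
Variable S : coverSeq.
Implicit Types x y : inverse_limit S.

(** Vertices of all levels in one type.  Iterating [parent] changes the level
without any transport along equalities between natural numbers. *)
Definition parent (t : {n & S n}) : {n & S n} :=
  match t with
  | existT n.+1 v => existT _ n (@cproj S n v)
  | _ => t
  end.

Lemma tag_iter_parent k (t : {n & S n}) : tag (iter k parent t) = (tag t - k)%N.
Proof.
elim: k t => [|k IH] [n v]; first by rewrite subn0.
by rewrite iterSr IH; case: n v => [|n] v; rewrite /= ?sub0n ?subSS.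
Qed.

(** Lift [v] step by step to the levels [N], [N + 1], and so on, then take the
[N]-th ancestor of the lift of level [n + N] as the vertex of level [n]. *)
Lemma exists_thread N (v : S N) : exists x, lcoord x N = v.
Proof.
have /choice[c cP] (t : {n & S n}) : exists t', tag t' = (tag t).+1 /\ parent t' = t.
  by case: t => n w; have [u ->] := cproj_surj w; exists (existT _ n.+1 u).
pose t k := iter k c (existT _ N v).
have tN k : tag (t k) = (k + N)%N by elim: k => //= k IH; rewrite (cP _).1 IH.
have [x xP] : exists x : forall n, S n,
    forall n, existT _ n (x n) = iter N parent (t n).
  suff /dependent_choice : forall n, exists w : S n, existT _ n w = iter N parent (t n).
    by [].
  move=> n; have : tag (iter N parent (t n)) = n.
    by rewrite tag_iter_parent tN addnK.
  by case: (iter _ _ _) => n' w /= ne; subst n'; exists w.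
have [|y yE] := @mk_limit S x.
  move=> n; apply: (@eq_from_Tagged nat (fun n => S n) _); rewrite /Tagged xP.
  rewrite -[existT _ n _]/(parent (existT _ n.+1 (x n.+1))) xP -iterS iterSr.
  by rewrite /= (cP _).2.
exists y; rewrite yE; apply: (@eq_from_Tagged nat (fun n => S n) _); rewrite /Tagged xP /t.
by elim: {1 2}N => // k IH; rewrite iterSr /= (cP _).2.
Qed.

Lemma lcoord_below x y m N : (m <= N)%N -> lcoord x N = lcoord y N ->
  lcoord x m = lcoord y m.
Proof.
move=> /subnK <-; elim: (N - m)%N => //= k IH xy; apply: IH.
by rewrite (lcoordP x) (lcoordP y); congr cproj.
Qed.

Definition thread N (v : S N) : inverse_limit S := projT1 (cid (exists_thread v)).

Lemma threadK N (v : S N) : lcoord (thread v) N = v.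
Proof. by rewrite /thread; case: cid. Qed.

(** For [m <= N] this is the projection from level [N] to level [m].  Going through
a point of the inverse limit defines it for all pairs of indices, whereas
[cproj_iter] is tied to levels of the form [k + m]. *)
Definition vproj N m (v : S N) : S m := lcoord (thread v) m.

Lemma vproj_lcoord x N m : (m <= N)%N -> vproj m (lcoord x N) = lcoord x m.
Proof. by move=> mN; apply: lcoord_below mN _; rewrite threadK. Qed.

Lemma cproj_iterE k n : @cproj_iter S k n = @vproj (k + n)%N n.
Proof.
apply/funext => v; rewrite -[v]threadK vproj_lcoord ?leq_addl //.
move: (thread v) => {v} x; elim: k => //= k IH.
by rewrite -lcoordP.
Qed.

Definition ecoord n x : gedge (S n) :=
  exist _ (lcoord x n, lcoord (limit_map x) n) ((limit_mapP x _).1 erefl n).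

(** An edge need not join the coordinates of a point and of its image a priori.
Lift it to an edge (u, v) of the next level: all edges leaving u project to
edges with the same target, so any point through u does. *)
Lemma ecoord_surj n (e : gedge (S n)) : exists x, ecoord n x = e.
Proof.
have [imE out] := @cprojP S n.
have : [set e : S n * S n | edge e.1 e.2] (val e) by exact: (valP e).
rewrite -imE => -[[u v] /= uv eE]; exists (thread u); apply: val_inj.
transitivity (map_edge (@cproj S n) (u, v)); last exact: eE.
rewrite /= [lcoord (thread u) n]lcoordP [lcoord (limit_map _) n]lcoordP threadK.
congr (_, _).
apply: out uv; have := (limit_mapP (thread u) _).1 erefl n.+1.
by rewrite threadK.
Qed.

Lemma map_edge_ecoord N m x : (m <= N)%N ->
  map_edge (@vproj N m) (val (ecoord N x)) = val (ecoord m x).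
Proof. by move=> mN; rewrite /map_edge /= !vproj_lcoord. Qed.

Definition eproj N m (e : gedge (S N)) : gedge (S m) :=
  ecoord m (projT1 (cid (ecoord_surj e))).

Lemma map_edge_eproj N m (e : gedge (S N)) : (m <= N)%N ->
  map_edge (@vproj N m) (val e) = val (eproj m e).
Proof.
move=> mN; rewrite /eproj; case: cid => x /= <-; exact: map_edge_ecoord.
Qed.

Lemma eproj_ecoord N m x : (m <= N)%N -> eproj m (ecoord N x) = ecoord m x.
Proof. by move=> mN; apply: val_inj; rewrite -map_edge_eproj // map_edge_ecoord. Qed.

End Threads.

(** * Projections of flows between levels *)

Section Push.
Variables (R : realType) (S : coverSeq).

(** The map [xi] in terms of its two levels, thanks to [vproj]. *)
Definition xito N m (a : {ffun gedge (S N) -> R}) : {ffun gedge (S m) -> R} :=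
  push (@vproj S N m) a.

Lemma xiE k n (a : {ffun gedge (S (k + n)%N) -> R}) : xi S k n a = xito n a.
Proof. by rewrite /xi cproj_iterE. Qed.

Lemma xitoE N m (a : {ffun gedge (S N) -> R}) e : (m <= N)%N ->
  xito m a e = \sum_(e' | eproj m e' == e) a e'.
Proof.
move=> mN; rewrite ffunE; apply: eq_bigl => e'.
by rewrite map_edge_eproj // (inj_eq val_inj).
Qed.

Lemma sum_xito N m (a : {ffun gedge (S N) -> R}) (Q : pred (gedge (S m))) :
  (m <= N)%N -> \sum_(e | Q e) xito m a e = \sum_(e | Q (eproj m e)) a e.
Proof.
move=> mN; rewrite [RHS](partition_big (eproj m) Q) //=.
apply: eq_bigr => e Qe; rewrite xitoE //; apply: eq_bigl => e'.
by case: eqP => [->|]; rewrite ?Qe ?andbF.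
Qed.

Lemma xito_comp N n m (a : {ffun gedge (S N) -> R}) : (m <= n)%N -> (n <= N)%N ->
  xito m (xito n a) = xito m a.
Proof.
move=> mn nN; apply/ffunP => e; rewrite !xitoE ?(leq_trans mn) // sum_xito //.
apply: eq_bigl => e'; have [x <-] := ecoord_surj e'.
by rewrite !eproj_ecoord ?(leq_trans mn).
Qed.

Lemma xito_linear N m : linear (@xito N m).
Proof.
move=> t a b; apply/ffunP => e; rewrite !ffunE scaler_sumr -big_split /=.
by apply: eq_bigr => e' _; rewrite !ffunE.
Qed.
HB.instance Definition _ N m := GRing.isLinear.Build R _ _ _ (@xito N m) (@xito_linear N m).

Lemma xito_flow N m (a : {ffun gedge (S N) -> R}) : (m <= N)%N ->
  flow_polytope a -> flow_polytope (xito m a).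
Proof.
move=> mN [a0 a1 ab]; split.
- by move=> e; rewrite xitoE // sumr_ge0.
- by rewrite sum_xito.
- move=> v; rewrite !sum_xito //.
  have E (h : forall n, S n * S n -> S n) :
      (forall e, h m (map_edge (@vproj S N m) e) = vproj m (h N e)) ->
      \sum_(e | h m (val (eproj m e)) == v) a e =
      \sum_(e : gedge (S N) | vproj m (h N (val e)) == v) a e.
    by move=> hE; apply: eq_bigl => e; rewrite -map_edge_eproj // hE.
  rewrite (E (fun n => fst)) // (E (fun n => snd)) //.
  exact: (balanced_sum (fun w => vproj m w == v) ab).
Qed.

Lemma Delta_inftyP (z : forall n, {ffun gedge (S n) -> R}) :
  Delta_infty z <-> (forall n, flow_polytope (z n)) /\
    (forall N m, (m <= N)%N -> xito m (z N) = z m).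
Proof.
split=> -[zf zxi]; split=> //.
  by move=> N m mN; have := zxi (N - m)%N m; rewrite xiE subnK.
by move=> k n; rewrite xiE zxi // leq_addl.
Qed.

Lemma limit_alongP N (x y : forall n, {ffun gedge (S n) -> R}) :
  limit_along N x y <-> forall m (eps : R), 0 < eps -> exists n0 : nat,
    forall n, N n -> (m <= n)%N -> (n0 <= n)%N ->
      eucl_dist (xito m (x n)) (y m) < eps.
Proof.
split=> xy m eps /(xy m)[n0 n0P]; exists n0.
  by move=> n Nn mn n0n; have := n0P (n - m)%N; rewrite xiE subnK //; apply.
by move=> k Nk n0k; rewrite xiE; apply: n0P => //; rewrite leq_addl.
Qed.

End Push.

(** * Borel sets of the inverse limit *)

Section Borel.
Variable S : coverSeq.
Implicit Types x y : inverse_limit S.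

Definition level n (Q : pred (S n)) : set (inverse_limit S) :=
  [set x | Q (lcoord x n)].

(** Predicates, rather than single vertices, make this family stable under
intersections: raise both predicates to a common level. *)
Definition levels : set (set (inverse_limit S)) :=
  [set A | exists n (Q : pred (S n)), A = level Q].

Lemma level_raise n N (Q : pred (S n)) : (n <= N)%N ->
  level Q = level (fun v : S N => Q (vproj n v)).
Proof. by move=> nN; apply/seteqP; split=> x; rewrite /level /= vproj_lcoord. Qed.

Lemma levels_setI : setI_closed levels.
Proof.
move=> _ _ [n [Q ->]] [m [P ->]]; pose N := maxn n m.
exists N, (fun v => Q (vproj n v) && P (vproj m v)).
rewrite (level_raise Q (leq_maxl n m)) (level_raise P (leq_maxr n m)).
by apply/seteqP; split=> x => [[Qx Px]|/andP[]//]; apply/andP.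
Qed.

(** One more level of a point determines a coordinate of its image: this is the
condition on edges with a common source in the definition of a cover. *)
Lemma ecoord_below n x y : lcoord x n.+1 = lcoord y n.+1 -> ecoord n x = ecoord n y.
Proof.
move=> xy; apply: val_inj; rewrite /= (lcoord_below (leqnSn n) xy).
congr (_, _); rewrite [LHS]lcoordP [RHS]lcoordP.
have [_ +] := @cprojP S n; apply; last exact: ((limit_mapP y _).1 erefl n.+1).
by rewrite -xy; exact: ((limit_mapP x _).1 erefl n.+1).
Qed.

Lemma ecoord_level n (Q : pred (gedge (S n))) :
  [set x | Q (ecoord n x)] = level (fun v : S n.+1 => Q (ecoord n (thread v))).
Proof.
by apply/seteqP; split=> x;
   rewrite /level /= (@ecoord_below n x (thread (lcoord x n.+1))) ?threadK.
Qed.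

Lemma limit_map_level n (Q : pred (S n)) :
  @limit_map S @^-1` level Q = [set x | Q (val (ecoord n x)).2].
Proof. by []. Qed.

Lemma open_level n (Q : pred (S n)) : open (level Q).
Proof.
pose g (x : prod_topology (fun n => discrete_topology (S n))) : discrete_topology (S n) := x n.
have gc : continuous g by apply: proj_continuous.
exists (g @^-1` [set v | Q v]) => //.
by apply: open_comp => [x _|]; [exact: gc|exact: discrete_open].
Qed.

(** The filter generated by the cylinders around [x] converges to [x], since each
coordinate is eventually constant along it; so it contains every neighbourhood
of [x]. *)
Lemma nbhs_cylinder x (A : set (inverse_limit S)) : open A -> A x ->
  exists n, cylinder (lcoord x n) `<=` A.
Proof.
move=> [B Bo <-] Bx.
pose F := filter_from [set: nat] (fun n => [set y : prod_topology (fun n => discrete_topology (S n)) |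
   forall m, (m <= n)%N -> y m = val x m]).
have FF : Filter F.
  apply: filter_fromT_filter; first by exists 0%N.
  move=> i j; exists (maxn i j) => y yx; split=> m mi; apply: yx.
    by rewrite (leq_trans mi) // leq_maxl.
  by rewrite (leq_trans mi) // leq_maxr.
have Fx : F --> (val x : prod_topology (fun n => discrete_topology (S n))).
  apply/cvg_sup => i; apply/cvg_image.
    by apply/seteqP; split => // v _; exists (dfwith (val x) i v) => //; rewrite dfwithin.
  move=> C Cx; exists (fun y : prod_topology (fun n => discrete_topology (S n)) => C (y i)).
    by exists i => // y /(_ i (leqnn i)) /= ->; exact: nbhs_singleton.
  apply/seteqP; split=> [v [y Cy <-]//|v Cv].
  by exists (dfwith (val x) i v) => //=; rewrite ?dfwithin.
have /Fx [n _ nB] : nbhs (val x : prod_topology (fun n => discrete_topology (S n))) B.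
  exact: open_nbhs_nbhs.
exists n => y yx; apply: nB => m mn.
exact: (lcoord_below mn yx).
Qed.

(** An open set is the union over [n] of its largest subset that depends on the
[n]-th coordinate only; these unions are countable. *)
Lemma measurable_borelE : @measurable _ (borel_limit S) = <<s levels >>.
Proof.
apply/seteqP; split.
  apply: smallest_sub; first exact: smallest_sigma_algebra.
  move=> A oA; pose Q n (v : S n) := `[< cylinder v `<=` A >].
  have -> : A = \bigcup_n level (@Q n).
    apply/seteqP; split=> [x Ax|x [n _ /asboolP]]; last by apply.
    by have [n nA] := nbhs_cylinder oA Ax; exists n => //; apply/asboolP.
  by apply: sigma_algebra_bigcup => n; apply: sub_sigma_algebra; exists n, (@Q n).
apply: smallest_sub; first exact: smallest_sigma_algebra.
by move=> _ [n [Q ->]]; apply: sub_sigma_algebra; exact: open_level.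
Qed.

Lemma measurable_level n (Q : pred (S n)) :
  measurable (level Q : set (borel_limit S)).
Proof. by rewrite measurable_borelE; apply: sub_sigma_algebra; exists n, Q. Qed.

Lemma measurable_ecoord n (Q : pred (gedge (S n))) :
  measurable ([set x | Q (ecoord n x)] : set (borel_limit S)).
Proof. by rewrite ecoord_level; exact: measurable_level. Qed.

Lemma measurable_limit_map :
  measurable_fun setT (@limit_map S : borel_limit S -> borel_limit S).
Proof.
apply: (measurability _ (measurable_borelE)).
move=> _ [_ [n [Q ->]] <-]; rewrite setTI limit_map_level.
exact: (measurable_ecoord (fun e => Q (val e).2)).
Qed.

End Borel.
Arguments levels : clear implicits.
Arguments measurable_borelE : clear implicits.

(** * Measures and their vectors *)

Lemma measure_finType_partition d (T : measurableType d) (R : realType)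
    (mu : {measure set T -> \bar R}) (I : finType) (g : T -> I) (Q : pred I) :
  (forall Q : pred I, measurable [set x | Q (g x)]) ->
  (mu [set x | Q (g x)] = \sum_(i | Q i) mu [set x | g x = i])%E.
Proof.
move=> mg; rewrite -big_enum /=.
have -> : [set x | Q (g x)] = [set x | g x \in enum Q].
  by apply/seteqP; split=> x; rewrite /= mem_enum.
elim: (enum Q) (enum_uniq Q) => [_|i s IH /= /andP[si us]].
  rewrite big_nil [X in mu X](_ : _ = set0) ?measure0 //.
  by apply/seteqP; split.
rewrite big_cons -IH // -measureU.
- by congr (mu _); apply/seteqP; split=> x /=; rewrite inE;
    [case/predU1P => ->; [left|right]|case => [->|->]; rewrite ?eqxx ?orbT].
- have := mg (pred1 i); congr (measurable _).
  by apply/seteqP; split=> x /= /eqP.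
- exact: (mg (mem s)).
- apply/seteqP; split=> // x [/= gxi]; rewrite gxi.
  by rewrite (negPf si).
Qed.

Section Measures.
Variables (R : realType) (S : coverSeq).
Implicit Types mu nu : probability (borel_limit S) R.

Lemma edge_cylinderE n (e : gedge (S n)) : edge_cylinder e = [set x | ecoord n x = e].
Proof.
apply/seteqP; split=> x /=; last by move=> <-; split.
move=> [xe fxe]; apply: val_inj; rewrite /= xe fxe.
by rewrite -surjective_pairing.
Qed.

Lemma measurable_edge_cylinder n (e : gedge (S n)) :
  measurable (edge_cylinder e : set (borel_limit S)).
Proof.
rewrite edge_cylinderE; have := measurable_ecoord (pred1 e).
by congr (measurable _); apply/seteqP; split=> x /= /eqP.
Qed.

Lemma measure_vecE n mu (Q : pred (gedge (S n))) :
  (mu [set x | Q (ecoord n x)] = (\sum_(e | Q e) measure_vec mu n e)%:E)%E.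
Proof.
rewrite (measure_finType_partition mu (g := ecoord n)); last first.
  exact: measurable_ecoord.
rewrite -sumEFin; apply: eq_bigr => e _.
rewrite ffunE -edge_cylinderE fineK // fin_num_measure //.
exact: measurable_edge_cylinder.
Qed.

Lemma measure_levelE n mu (Q : pred (S n)) :
  (mu (level Q) = (\sum_(e : gedge (S n) | Q (val e).1) measure_vec mu n e)%:E)%E.
Proof. exact: (measure_vecE mu (fun e => Q (val e).1)). Qed.

(** The sets [level Q] form a generating family stable under intersections, so the
uniqueness theorem for measures applies. *)
Lemma probability_levels_unique (mu : probability (borel_limit S) R)
    (nu : {measure set (borel_limit S) -> \bar R}) :
  (forall n (Q : pred (S n)), mu (level Q) = nu (level Q)) ->
  forall A, measurable A -> mu A = nu A.
Proof.
move=> munu A mA; pose T0 : set (borel_limit S) := @level S 0 predT.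
have T0E : T0 = setT by apply/seteqP.
apply: (@measure_unique _ R (borel_limit S) (levels S) (fun=> T0) _ _ _ _ mu nu).
- exact: measurable_borelE.
- exact: levels_setI.
- by move=> _; exists 0%N, predT.
- by rewrite T0E; apply/seteqP; split=> // x _; exists 0%N.
- by move=> _ [n [Q ->]]; apply: munu.
- by move=> _; rewrite T0E [X in (X < _)%E](probability_setT mu) ltry.
- exact: mA.
Qed.

Lemma measure_vec_inj mu nu : (forall n, measure_vec mu n = measure_vec nu n) ->
  forall A, measurable A -> mu A = nu A.
Proof.
move=> munu; apply: (@probability_levels_unique mu nu) => n Q.
by rewrite [LHS]measure_levelE [RHS]measure_levelE munu.
Qed.

(** The measure of [level Q] and the one of its preimage are the sums of the same
vector over the edges with source, respectively target, in [Q]. *)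
Lemma invariant_measureP mu :
  invariant_measure mu <-> forall n, balanced (measure_vec mu n).
Proof.
split=> [inv n v|bal A mA].
  have := inv _ (measurable_level (pred1 v)).
  rewrite limit_map_level measure_levelE.
  by rewrite (measure_vecE mu (fun e => pred1 v (val e).2)) => -[->].
pose f : {mfun borel_limit S >-> borel_limit S} := mfun_Sub (mem_set (@measurable_limit_map S)).
suff /(_ A mA) -> : forall A, measurable A -> mu A = distribution mu f A by [].
apply: (@probability_levels_unique mu (distribution mu f)) => n Q.
rewrite [LHS]measure_levelE.
transitivity (mu [set x | Q (val (ecoord n x)).2]); last by [].
rewrite (measure_vecE mu (fun e => Q (val e).2)); congr (_%:E).
exact: balanced_sum.
Qed.

Lemma measure_vec_Delta mu : invariant_measure mu -> Delta_infty (measure_vec mu).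
Proof.
move=> /invariant_measureP bal; apply/Delta_inftyP; split=> [n|N m mN].
  split; [|apply: EFin_inj|exact: bal].
    by move=> e; rewrite ffunE fine_ge0.
  rewrite -(measure_vecE mu predT); transitivity (mu setT).
    by congr (mu _); apply/seteqP.
  exact: probability_setT.
apply/ffunP => e; rewrite xitoE //; apply: EFin_inj.
rewrite -(measure_vecE mu (fun e' => eproj m e' == e)).
transitivity (mu [set x | ecoord m x == e]).
  by congr (mu _); apply/seteqP; split=> x; rewrite /= eproj_ecoord.
by rewrite (measure_vecE mu (pred1 e)) big_pred1_eq.
Qed.

End Measures.

(** * The measure of a point of [Delta_infty] *)

Section FiniteCoding.
Variables (R : realType) (I : finType) (w : I -> R).
Hypothesis w0 : forall i, 0 <= w i.
Implicit Type P : pred I.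

(** Length of the union of the intervals that precede the one of rank [k], when
intervals of lengths [w j], for [j] in [P], are laid side by side. *)
Definition cumul P (k : nat) : R := \sum_(j | P j && (enum_rank j < k)%N) w j.

Lemma cumulS P i : P i -> cumul P (enum_rank i).+1 = cumul P (enum_rank i) + w i.
Proof.
move=> Pi; rewrite /cumul (bigD1 i) ?Pi ?ltnSn //= addrC; congr (_ + _).
apply: eq_bigl => j; rewrite ltnS leq_eqVlt.
have -> : (enum_rank j == enum_rank i :> nat) = (j == i).
  by rewrite (inj_eq val_inj) (inj_eq enum_rank_inj).
case: eqP => [->|]; rewrite ?ltnn ?andbF ?andbT //.
Qed.

Lemma le_cumul P k l : (k <= l)%N -> cumul P k <= cumul P l.
Proof.
move=> kl; rewrite /cumul big_mkcond [leRHS]big_mkcond; apply: ler_sum => j _.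
case: (P j) => //=; case: ltnP => [jk|_]; first by rewrite (leq_trans jk kl).
by case: ifP.
Qed.

Lemma cumul_le P i : P i -> cumul P (enum_rank i) + w i <= \sum_(j | P j) w j.
Proof.
move=> Pi; rewrite -cumulS // [leRHS](_ : _ = cumul P #|I|) ?le_cumul //.
by apply: eq_bigl => j; rewrite ltn_ord andbT.
Qed.

Lemma cumul_ge0 P k : 0 <= cumul P k.
Proof. exact: sumr_ge0. Qed.

Lemma cumul_interval_inj P i j t : P i -> P j ->
  cumul P (enum_rank i) <= t < cumul P (enum_rank i) + w i ->
  cumul P (enum_rank j) <= t < cumul P (enum_rank j) + w j -> i = j.
Proof.
move=> Pi Pj; rewrite -!cumulS // => /andP[it ti] /andP[jt tj].
apply: enum_rank_inj; apply: val_inj; apply/eqP; rewrite eqn_leq.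
apply/andP; split; rewrite leqNgt; apply/negP => /(le_cumul P).
  by move=> /le_lt_trans /(_ (le_lt_trans it tj)); rewrite ltxx.
by move=> /le_lt_trans /(_ (le_lt_trans jt ti)); rewrite ltxx.
Qed.

Lemma cumul_interval_exists P t : 0 <= t < \sum_(j | P j) w j ->
  exists2 i, P i & cumul P (enum_rank i) <= t < cumul P (enum_rank i) + w i.
Proof.
move=> /andP[t0 tw].
have ex : exists k, t < cumul P k.
  exists #|I|; rewrite (_ : cumul _ _ = \sum_(j | P j) w j) //.
  by apply: eq_bigl => j; rewrite ltn_ord andbT.
case: (ex_minnP ex) => -[|k] kt kmin.
  by move: kt; rewrite /cumul big_pred0 ?ltNge ?t0 // => j; rewrite ltn0 andbF.
have tk : cumul P k <= t by rewrite leNgt; apply/negP => /kmin; rewrite ltnn.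
have [kI|Ik] := ltnP k #|I|; last first.
  move: kt; rewrite (_ : cumul P k.+1 = cumul P k) ?ltNge ?tk //.
  apply: eq_bigl => j; congr (_ && _).
  by rewrite ltnS (leq_trans (ltn_ord _) Ik) (ltnW (leq_trans (ltn_ord _) Ik)).
pose i : I := enum_val (Ordinal kI).
have ik : enum_rank i = k :> nat by rewrite /i enum_valK.
have Pi : P i.
  apply: contraLR kt => Pi; rewrite -leNgt; apply: le_trans tk.
  rewrite /cumul (eq_bigl (fun j => P j && (enum_rank j < k)%N)) // => j.
  rewrite ltnS leq_eqVlt -{1}ik (inj_eq val_inj) (inj_eq enum_rank_inj).
  by case: eqP => [->|//]; rewrite (negPf Pi).
by exists i => //; rewrite ik tk -ik -cumulS // ik.
Qed.

End FiniteCoding.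

Lemma vertex0_unique (S : coverSeq) (u v : S 0%N) : u = v.
Proof.
have /fintype_le1P/(_ u v) -> // : (#|S 0%N| <= 1)%N by rewrite cgraph0.
Qed.

Section Coding.
Variables (R : realType) (S : coverSeq).
Variable z : forall n, {ffun gedge (S n) -> R}.
Hypothesis zD : Delta_infty z.

Definition vweight n (v : S n) : R := \sum_(e : gedge (S n) | (val e).1 == v) z n e.

Lemma vweight_ge0 n (v : S n) : 0 <= vweight v.
Proof. by apply: sumr_ge0 => e _; have [/(_ n)[]] := zD. Qed.

Lemma vweight_fibre n (v : S n) :
  vweight v = \sum_(u : S n.+1 | cproj u == v) vweight u.
Proof.
have [_ /(_ n.+1 n (leqnSn n)) zE] := (Delta_inftyP z).1 zD.
rewrite /vweight -{1}zE sum_xito //.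
rewrite (partition_big (fun e : gedge (S n.+1) => (val e).1)
  (fun u => cproj u == v)) => [|e]; last first.
  by have [x <-] := ecoord_surj e; rewrite eproj_ecoord //= -lcoordP.
apply: eq_bigr => u /eqP uv; apply: eq_bigl => e.
have [x <-] := ecoord_surj e; rewrite eproj_ecoord //= lcoordP.
by case: (_ =P u) => [->|]; rewrite ?uv ?eqxx ?andbF.
Qed.

Lemma sum_vweight n (Q : pred (S n)) :
  \sum_(v | Q v) vweight v = \sum_(e : gedge (S n) | Q (val e).1) z n e.
Proof. exact/esym/(sum_gedge_vertex fst). Qed.

Lemma sum_vweight1 n : \sum_(v : S n) vweight v = 1.
Proof. by rewrite (sum_vweight predT); have [/(_ n)[]] := zD. Qed.

Definition sibling n (u : S n.+1) : pred (S n.+1) := fun u' => cproj u' == cproj u.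

(** The unit interval is cut into one interval for each vertex of level [n], of
length the weight of the vertex; passing to the next level cuts the interval of
[v] into intervals for the vertices above [v].  A number then codes the point of
the inverse limit whose vertices are the ones of the intervals that contain it,
and the image of Lebesgue measure under this coding has the prescribed weights. *)
Fixpoint start n : S n -> R :=
  if n is n'.+1 then
    fun u => start (cproj u) + cumul (@vweight n'.+1) (sibling u) (enum_rank u)
  else fun=> 0.

Definition slot n (v : S n) : set R := `[start v, start v + vweight v[%classic.

Lemma slotE n (v : S n) t : slot v t = (start v <= t < start v + vweight v).
Proof. by rewrite /slot /= in_itv. Qed.

Lemma slotS n (u : S n.+1) t : slot u t ->
  let c := cumul (@vweight n.+1) (sibling u) (enum_rank u) in
  c <= t - start (cproj u) < c + vweight u.
Proof. by rewrite slotE /= => /andP[? ?]; apply/andP; split; lra. Qed.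

Lemma slot_cproj n (u : S n.+1) : slot u `<=` slot (cproj u).
Proof.
move=> t; rewrite !slotE /= => /andP[t1 t2].
have c0 := @cumul_ge0 _ _ (@vweight n.+1) (@vweight_ge0 n.+1) (sibling u) (enum_rank u).
have := @cumul_le _ _ (@vweight n.+1) (@vweight_ge0 n.+1) (sibling u) u (eqxx _).
rewrite -vweight_fibre => c1; apply/andP; split; lra.
Qed.

Lemma sibling_ext n (u u' : S n.+1) : cproj u = cproj u' -> sibling u = sibling u'.
Proof. by move=> uu'; rewrite /sibling uu'. Qed.

Lemma slot_inj n (u v : S n) t : slot u t -> slot v t -> u = v.
Proof.
elim: n u v => [|n IH] u v ut vt.
  exact: vertex0_unique.
have uv := IH _ _ (slot_cproj ut) (slot_cproj vt).
have := slotS vt; have := slotS ut; rewrite /= -uv -(sibling_ext uv).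
apply: cumul_interval_inj; [exact: vweight_ge0|exact: eqxx|].
by rewrite /sibling uv.
Qed.

Lemma slot_exists n (t : R) : 0 <= t < 1 -> exists v : S n, slot v t.
Proof.
move=> t01; elim: n => [|n [v vt]].
  have [v _] : exists v : S 0%N, True.
    by have [x _] := inverse_limit_nonempty S; exists (lcoord x 0).
  exists v; rewrite slotE add0r (_ : vweight v = 1) //.
  rewrite -(sum_vweight1 0) (big_pred1 v) // => u.
  by rewrite (vertex0_unique u v) /= eqxx.
have [u0 u0v] := cproj_surj v.
have [|u uv tu] := @cumul_interval_exists _ _ (@vweight n.+1)
    (sibling u0) (t - start v).
  rewrite /sibling -u0v -vweight_fibre; move: vt; rewrite slotE => /andP[? ?].
  apply/andP; split; lra.
exists u; have {}uv : cproj u = v by rewrite u0v; apply/eqP.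
rewrite slotE /= uv (@sibling_ext _ u u0) ?uv //.
by move: tu => /andP[? ?]; apply/andP; split; lra.
Qed.

(** The constant value outside the unit interval keeps the coding measurable. *)
Lemma code_exists (t : R) : exists x : inverse_limit S,
  (0 <= t < 1 -> forall n, slot (lcoord x n) t) /\
  (~~ (0 <= t < 1) -> x = point).
Proof.
have [t01|_] := boolP (0 <= t < 1); last first.
  by exists point.
have [x xP] := dependent_choice (fun n => slot_exists n t01).
have [|y yE] := @mk_limit S x.
  by move=> n; apply: slot_inj (xP n) _; apply: slot_cproj.
by exists y; split => // _ n; rewrite yE.
Qed.

Definition code t : inverse_limit S := projT1 (cid (code_exists t)).

Lemma codeP t n (v : S n) : 0 <= t < 1 -> lcoord (code t) n = v <-> slot v t.
Proof.
move=> t01; rewrite /code; case: cid => x [/(_ t01 n) xt _] /=.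
by split=> [<-//|]; apply: slot_inj.
Qed.

Lemma slot01 n (v : S n) : slot v `<=` `[0, 1[%classic.
Proof.
elim: n v => [|n IH] v; last exact: subset_trans (@slot_cproj _ _) (IH _).
move=> t; rewrite slotE /= in_itv /= add0r => /andP[-> /lt_le_trans]; apply.
by rewrite -(sum_vweight1 0) (bigD1 v) //= lerDl sumr_ge0 // => *; exact: vweight_ge0.
Qed.

Lemma code_level n (Q : pred (S n)) :
  code @^-1` level Q `&` `[0, 1[%classic = \bigcup_(v in [set v | Q v]) slot v.
Proof.
apply/seteqP; split=> t.
  move=> [Qt]; rewrite /= in_itv /= => t01.
  by exists (lcoord (code t) n) => //; apply/codeP.
move=> [v Qv vt]; split; last exact: slot01 vt.
have := slot01 vt; rewrite /= in_itv /= => t01.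
by rewrite /level /=; have /codeP -> := vt.
Qed.

Lemma measurable_slots n (Q : pred (S n)) :
  measurable (\bigcup_(v in [set v | Q v]) slot v).
Proof. by apply: fin_bigcup_measurable => // v _; exact: measurable_itv. Qed.

Lemma measurable_code : measurable_fun setT (code : measurableTypeR R -> borel_limit S).
Proof.
apply: (measurability _ (measurable_borelE S)) => _ [_ [n [Q ->]] <-].
rewrite setTI -(setUIDK (code @^-1` level Q) `[0, 1[%classic).
apply: measurableU; first by rewrite code_level; exact: measurable_slots.
rewrite setDE (_ : _ `&` _ = [set t | Q (lcoord (point : inverse_limit S) n)] `&`
                              ~` `[0, 1[%classic).
  apply: measurableI; last exact: measurableC.
  have [Qp|Qp] := boolP (Q (lcoord (point : inverse_limit S) n)).
    by rewrite [X in measurable X](_ : _ = setT) //; apply/seteqP.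
  by rewrite [X in measurable X](_ : _ = set0) //; apply/seteqP; split=> t /=; rewrite ?(negPf Qp).
have codeN t : (~` `[0, 1[%classic) t -> code t = point.
  by rewrite /code; case: cid => x /= [_ +] /negP; rewrite in_itv; apply.
by apply/seteqP; split=> t [tQ t01]; split => //; move: tQ; rewrite /level /= codeN.
Qed.

(** The restricted measure has total mass 1; the normalisation leaves it unchanged
and equips it with the structure of a probability. *)
Definition unit_interval_prob : probability (measurableTypeR R) R :=
  mnormalize (mrestr lebesgue_measure (measurable_itv `[(0:R), 1[)) (dirac (point : measurableTypeR R)).

Lemma unit_interval_probE A : unit_interval_prob A = lebesgue_measure (A `&` `[0, 1[%classic).
Proof.
rewrite /unit_interval_prob /= /mnormalize /= /mrestr setTI.
rewrite lebesgue_measure_itv /= lte_fin ltr01 oppr0 adde0.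
by rewrite onee_eq0 /= invr1 mule1.
Qed.

Definition coded_measure : probability (borel_limit S) R :=
  distribution unit_interval_prob (mfun_Sub (mem_set measurable_code)).

Lemma lebesgue_slot n (v : S n) : lebesgue_measure (slot v) = (vweight v)%:E.
Proof.
rewrite /slot lebesgue_measure_itv /= lte_fin ltrDl -EFinD.
have [_|w0] := ltP; first by congr (_%:E); ring.
by congr (_%:E); apply/eqP; rewrite eq_le w0 vweight_ge0.
Qed.

Lemma coded_level n (Q : pred (S n)) :
  coded_measure (level Q) = (\sum_(v | Q v) vweight v)%:E.
Proof.
rewrite (measure_finType_partition coded_measure (g := fun x => lcoord x n)); last first.
  exact: measurable_level.
rewrite -sumEFin; apply: eq_bigr => v _.
transitivity (unit_interval_prob (code @^-1` level (pred1 v))).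
  by congr (unit_interval_prob _); apply/seteqP; split=> t /= /eqP.
rewrite unit_interval_probE code_level -lebesgue_slot; congr (lebesgue_measure _).
by apply/seteqP; split=> [t [u /eqP ->]//|t vt]; exists v => //=; rewrite eqxx.
Qed.

(** The cylinder of an edge of level [n] is a union of cylinders of vertices of
level [n + 1]; its weight is the total weight of the edges of level [n + 1] that
project to the given edge, which is [z n e] by compatibility. *)
Lemma coded_measure_vec n : measure_vec coded_measure n = z n.
Proof.
have [_ /(_ n.+1 n (leqnSn n)) zE] := (Delta_inftyP z).1 zD.
apply/ffunP => e; apply: EFin_inj; rewrite -[LHS]/((measure_vec coded_measure n e)%:E).
rewrite -[measure_vec _ _ _](big_pred1_eq +%R e) -(measure_vecE coded_measure (pred1 e)).
rewrite (ecoord_level (pred1 e)) coded_level sum_vweight; congr (_%:E).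
rewrite -zE xitoE //; apply: eq_bigl => e' /=; congr (_ == _).
have [x <-] := ecoord_surj e'; rewrite eproj_ecoord //.
by apply: ecoord_below; rewrite threadK.
Qed.

End Coding.

Theorem Delta_infty_measure (R : realType) (S : coverSeq)
    (z : forall n, {ffun gedge (S n) -> R}) : Delta_infty z ->
  exists2 mu : probability (borel_limit S) R,
    invariant_measure mu & forall n, measure_vec mu n = z n.
Proof.
move=> zD; exists (coded_measure zD); last exact: coded_measure_vec.
apply/invariant_measureP => n; rewrite coded_measure_vec.
by have [/(_ n)[]] := zD.
Qed.

(** * Limits along ultrafilters *)

Definition frequently (A : set nat) : Prop := forall k, exists2 n, (k <= n)%N & A n.

Definition tail_ultrafilter (U : set_system nat) : Prop :=
  UltraFilter U /\ forall k, U [set n | (k <= n)%N].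

Lemma exists_tail_ultrafilter (A : set nat) : frequently A ->
  exists U, tail_ultrafilter U /\ U A.
Proof.
move=> Af; pose F := filter_from [set: nat] (fun k => A `&` [set n | (k <= n)%N]).
have FF : ProperFilter F.
  apply: filter_from_proper; last by move=> k _; have [n kn An] := Af k; exists n.
  apply: filter_fromT_filter; first by exists 0%N.
  move=> i j; exists (maxn i j) => n [An]; rewrite /= geq_max => /andP[ni nj].
  by split.
have [U [UU FU]] := ultraFilterLemma FF.
exists U; split; last by apply: FU; exists 0%N => // n [].
by split=> // k; apply: FU; exists k => // n [].
Qed.

Section Ultralimits.
Variables (R : realType) (U : set_system nat).
Hypothesis UU : tail_ultrafilter U.
Let Uultra : UltraFilter U := UU.1.
Let Uproper : ProperFilter U := @ultra_proper _ _ Uultra.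
Local Existing Instance Uproper.

Lemma near_ge k : \forall n \near U, (k <= n)%N.
Proof. exact: (UU.2 k). Qed.

Lemma bounded_ultralimit (a : nat -> R) :
  (\forall n \near U, 0 <= a n <= 1) -> exists l : R, a @ U --> l.
Proof.
move=> a01; have [|l [_ la]] := @segment_compact R 0 1 (a @ U) _.
  by near=> n => /=; rewrite in_itv /=; near: n.
exists l => B lB.
have [//|/= UB] := in_ultra_setVsetC (a @^-1` B) Uultra.
by have [r [rB /rB]] := la (~` B) B UB lB.
Unshelve. all: by end_near. Qed.

Lemma cvg_sumr (I : finType) (P : pred I) (a : I -> nat -> R) (l : I -> R) :
  (forall i, P i -> a i @ U --> l i) ->
  (fun n => \sum_(i | P i) a i n) @ U --> \sum_(i | P i) l i.
Proof.
by move=> al; apply: (cvg_big (op := +%R)) => // -[x y]; exact: add_continuous.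
Qed.

Lemma ultralimit_unique (a b : nat -> R) (k l : R) :
  a @ U --> k -> b @ U --> l -> (\forall n \near U, a n = b n) -> k = l.
Proof.
move=> ak bl ab; apply: (cvg_unique (@Rhausdorff R) ak).
by apply: cvg_trans bl; apply: near_eq_cvg; near=> n; rewrite (near ab n).
Unshelve. all: by end_near. Qed.

Lemma ultralimit_cst (a : nat -> R) (c l : R) :
  a @ U --> l -> (\forall n \near U, a n = c) -> l = c.
Proof. by move=> al ac; apply: ultralimit_unique al (cvg_cst c) ac. Qed.

(** All coordinates of all projections converge along an ultrafilter at once, and
the conditions defining [Delta_infty] are finite linear identities and
inequalities, hence pass to the limit.  This stands in for the compactness of
[Delta_infty]. *)
Lemma ultralimit_Delta (S : coverSeq) (x : forall n, {ffun gedge (S n) -> R}) :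
  (\forall n \near U, flow_polytope (x n)) ->
  exists2 y, Delta_infty y &
    forall m (e : gedge (S m)), (fun n => xito m (x n) e) @ U --> y m e.
Proof.
move=> xf.
have mf m : \forall n \near U, flow_polytope (xito m (x n)).
  near=> n; apply: xito_flow; near: n => //; exact: near_ge.
have /dependent_choice[y yl] : forall m, exists y : {ffun gedge (S m) -> R},
    forall e, (fun n => xito m (x n) e) @ U --> y e.
  move=> m; have /dependent_choice[y yl] : forall e : gedge (S m), exists l : R,
      (fun n => xito m (x n) e) @ U --> l.
    by move=> e; apply: bounded_ultralimit; near=> n; apply: flow_le1; near: n.
  by exists [ffun e => y e] => e; rewrite ffunE.
exists y => //; apply/Delta_inftyP; split=> [m|N m mN].
  split.
  - move=> e; apply: cvgr_to_ge (yl m e) _.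
    by near=> n; have [|+ _ _] := near (mf m) n => //; apply.
  - apply: (ultralimit_cst (cvg_sumr (fun e _ => yl m e))).
    by near=> n; have [|_ + _] := near (mf m) n.
  - move=> v; apply: ultralimit_unique (cvg_sumr (fun e _ => yl m e))
       (cvg_sumr (fun e _ => yl m e)) _.
    by near=> n; have [|_ _ +] := near (mf m) n => //; apply.
apply/ffunP => e; rewrite xitoE //.
apply: ultralimit_unique (cvg_sumr (fun e' _ => yl N e')) (yl m e) _.
near=> n; rewrite -xitoE // xito_comp //; near: n; exact: near_ge.
Unshelve. all: by end_near. Qed.

End Ultralimits.

(** * Extreme points of [Delta_infty] *)

Section SquaredDistance.
Variables (R : realType) (G : graph).
Implicit Types a b : {ffun gedge G -> R}.

Definition sqdist a b : R := \sum_e (a e - b e) ^+ 2.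

Lemma eucl_dist_lt a b eps : 0 < eps -> (eucl_dist a b < eps) = (sqdist a b < eps ^+ 2).
Proof.
by move=> e0; rewrite -{1}(ger0_norm (ltW e0)) -sqrtr_sqr ltr_sqrt // exprn_gt0.
Qed.

Lemma sqdist_ge0 a b : 0 <= sqdist a b.
Proof. by apply: sumr_ge0 => e _; exact: sqr_ge0. Qed.

Lemma sqdist_eq0 a b : sqdist a b <= 0 -> a = b.
Proof.
move=> ab; apply/ffunP => e; apply/eqP; rewrite -subr_eq0 -sqrf_eq0 eq_le sqr_ge0 andbT.
apply: le_trans ab; rewrite /sqdist (bigD1 e) //= lerDl.
by apply: sumr_ge0 => e' _; exact: sqr_ge0.
Qed.

Lemma sqdist_le2 a b : flow_polytope a -> flow_polytope b -> sqdist a b <= 2.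
Proof.
move=> fa fb; have [_ a1 _] := fa; have [_ b1 _] := fb.
rewrite -[2]/(1 + 1 : R) -{1}a1 -b1 -big_split; apply: ler_sum => e _.
have := flow_le1 e fa; have := flow_le1 e fb; move: (a e) (b e) => x y.
move=> /andP[y0 y1] /andP[x0 x1] /=; nra.
Qed.

(** Strict convexity of the squared distance, in quantitative form. *)
Lemma sqdist_convex t a b c :
  sqdist (t *: a + (1 - t) *: b) c =
  t * sqdist a c + (1 - t) * sqdist b c - t * (1 - t) * sqdist a b.
Proof.
rewrite /sqdist !big_distrr /= -big_split -sumrB; apply: eq_bigr => e _.
by rewrite !ffunE /GRing.scale /=; ring.
Qed.

End SquaredDistance.

Lemma ultralimit_sqdist (R : realType) (U : set_system nat) (G : graph)
    (a : nat -> {ffun gedge G -> R}) (b l : {ffun gedge G -> R}) :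
  tail_ultrafilter U -> (forall e, (fun n => a n e) @ U --> l e) ->
  (fun n => sqdist (a n) b) @ U --> sqdist l b.
Proof.
move=> UU al; have UP : ProperFilter U := @ultra_proper _ _ UU.1.
apply: (cvg_sumr UU) => e _.
have ab : (fun n => a n e - b e) @ U --> l e - b e.
  by apply: cvgB; [exact: al|exact: cvg_cst].
by under eq_fun do rewrite expr2; rewrite expr2; exact: (cvgM ab ab).
Qed.

Lemma exp_half_small (R : realType) (c : R) : 0 < c -> exists k : nat, 2^-1 ^+ k < c.
Proof.
move=> c0; exists (Num.bound c^-1).
rewrite exprVn -[ltRHS]invrK ltf_pV2 ?posrE ?invr_gt0 ?exprn_gt0 //.
apply: lt_trans (archi_boundP _) _; first by rewrite invr_ge0 ltW.
by rewrite -natrX ltr_nat ltn_expl.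
Qed.

Section Extreme.
Variables (R : realType) (S : coverSeq).
Local Notation family := (forall n, {ffun gedge (S n) -> R}).

(** Only [u n = z n] is required: exchanging the two summands gives the same for
[w]. *)
Definition extreme (z : family) : Prop := Delta_infty z /\
  forall t u w, 0 < t < 1 -> Delta_infty u -> Delta_infty w ->
    (forall n, z n = t *: u n + (1 - t) *: w n) -> forall n, u n = z n.

(** The normalised difference of [z] and [t *: u] completes [u] to a convex
decomposition of [z]. *)
Lemma extreme_dominated z u t : extreme z -> Delta_infty u -> 0 < t < 1 ->
  (forall n e, t * u n e <= z n e) -> forall n, u n = z n.
Proof.
move=> [zD zext] uD t01 uz; have [t0 t1] := andP t01.
have t1' : 1 - t != 0 by rewrite subr_eq0 gt_eqF.
pose w n := (1 - t)^-1 *: (z n - t *: u n).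
have [uf ux] := (Delta_inftyP u).1 uD; have [zf zx] := (Delta_inftyP z).1 zD.
apply: (zext t u w) => // [|n]; last by rewrite /w scalerA mulfV // scale1r addrC subrK.
apply/Delta_inftyP; split=> [n|N m mN]; last by rewrite /w linearZ linearB linearZ /= ux ?zx.
have E (Q : pred (gedge (S n))) : \sum_(e | Q e) w n e =
     (1 - t)^-1 * (\sum_(e | Q e) z n e - t * \sum_(e | Q e) u n e).
  rewrite big_distrr -sumrB big_distrr /=; apply: eq_bigr => e _.
  by rewrite !ffunE.
have [u0 u1 ub] := uf n; have [z0 z1 zb] := zf n.
split.
- move=> e; rewrite !ffunE mulr_ge0 ?invr_ge0 ?subr_ge0 ?(ltW t1) //.
  exact: uz.
- by rewrite E u1 z1 mulr1 mulVf.
- by move=> v; rewrite !E ub zb.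
Qed.

(** For an invariant set [A] of measure r strictly between 0 and 1, the conditional
measure [nu] given [A] is invariant and r times [nu] is at most [mu].  So [nu]
and [mu] agree, and [A], of measure 1 for [nu], has measure 1 for [mu]. *)
Lemma extreme_ergodic (mu : probability (borel_limit S) R) :
  invariant_measure mu -> extreme (measure_vec mu) -> ergodic_measure mu.
Proof.
move=> inv ext; split=> // A mA fA.
pose r := fine (mu A).
have rE : mu A = r%:E by rewrite /r fineK // fin_num_measure.
have r0 : 0 <= r by rewrite -lee_fin -rE.
have r1 : r <= 1 by rewrite -lee_fin -rE probability_le1.
rewrite rE; have [->|rN0] := eqVneq r 0; first by left.
have [->|rN1] := eqVneq r 1; [by right|exfalso].
have r01 : 0 < r < 1 by rewrite !lt_neqAle r0 r1 rN1 eq_sym rN0.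
pose nu : probability (borel_limit S) R := mnormalize (mrestr mu mA) mu.
have nuE B : nu B = (mu (B `&` A) * (r^-1)%:E)%E.
  by rewrite /nu /= /mnormalize /= /mrestr setTI rE eqe (negPf rN0).
have nuinv : invariant_measure nu.
  move=> B mB; rewrite !nuE -[in LHS]fA; congr (_ * _)%E.
  by apply: inv; exact: measurableI.
have nuvec : forall n, measure_vec nu n = measure_vec mu n.
  apply: (extreme_dominated ext (measure_vec_Delta nuinv) r01) => n e.
  have mC := measurable_edge_cylinder e.
  rewrite !ffunE nuE fineM ?fin_num_measure //; last exact: measurableI.
  rewrite /= mulrC divfK //.
  by apply: fine_le; rewrite ?fin_num_measure //; [exact: measurableI|
     apply: le_measure; rewrite ?inE //; exact: measurableI].
have := measure_vec_inj nuvec mA; rewrite nuE setIid rE -EFinM mulfV // => -[r1'].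
by rewrite -r1' eqxx in rN1.
Qed.

End Extreme.

Section Farthest.
Variables (R : realType) (S : coverSeq).
Local Notation family := (forall n, {ffun gedge (S n) -> R}).
Variable y : family.
Hypothesis yD : Delta_infty y.
Let flowD (x : family) n : Delta_infty x -> flow_polytope (x n).
Proof. by case=> /(_ n). Qed.

(** Partial sums of a weighted squared distance to [y]; the supremum [M] below, over
all points and all partial sums, is the maximum of the sum of the series. *)
Definition spread (x : family) (k : nat) : R :=
  \sum_(i < k) 2^-1 ^+ i * sqdist (x i) (y i).

Lemma half_ge0 k : 0 <= 2^-1 ^+ k :> R. Proof. by rewrite exprn_ge0 // invr_ge0. Qed.

Lemma spread_le x k l : (k <= l)%N -> spread x k <= spread x l.
Proof.
move=> /subnK <-; elim: (l - k)%N => // j IH; apply: le_trans IH _.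
by rewrite addSn /spread big_ord_recr /= lerDl mulr_ge0 ?half_ge0 ?sqdist_ge0.
Qed.

(** Squared distances between flows are at most 2, and the weights from [k] on add
up to twice the weight of index [k]. *)
Lemma spread_tail x k l : Delta_infty x -> spread x l <= spread x k + 4 * 2^-1 ^+ k.
Proof.
move=> xD; have [lk|kl] := leqP l k.
  by rewrite (le_trans (spread_le _ lk)) // lerDl mulr_ge0 ?half_ge0.
suff : spread x l <= spread x k + 4 * 2^-1 ^+ k - 4 * 2^-1 ^+ l.
  by move=> /le_trans; apply; rewrite gerBl mulr_ge0 ?half_ge0.
rewrite -(subnK (ltnW kl)); elim: (l - k)%N => [|j IH]; first by rewrite addrK.
rewrite addSn /spread big_ord_recr /= -/(spread _ _) exprS.
have := sqdist_le2 (flowD (j + k) xD) (flowD (j + k) yD).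
move: IH (half_ge0 (j + k)); move: (spread _ _) (sqdist _ _) (2^-1 ^+ _) (spread _ _ + _).
by move=> a b c d *; nra.
Qed.

Lemma spread_convex t (u w z : family) k :
  (forall n, z n = t *: u n + (1 - t) *: w n) ->
  spread z k = t * spread u k + (1 - t) * spread w k -
    t * (1 - t) * \sum_(i < k) 2^-1 ^+ i * sqdist (u i) (w i).
Proof.
move=> zE; rewrite /spread !big_distrr /= -big_split -sumrB; apply: eq_bigr => i _.
by rewrite zE sqdist_convex /=; ring.
Qed.

Let M := sup [set spread x k | x in @Delta_infty R S & k in [set: nat]].

Lemma spread_has_sup : has_sup [set spread x k | x in @Delta_infty R S & k in [set: nat]].
Proof.
split; first by exists (spread y 0), y => //; exists 0%N.
exists 4 => _ [x xD [k _ <-]].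
by have := spread_tail 0 k xD; rewrite /spread big_ord0 add0r expr0 mulr1.
Qed.

Lemma spread_le_sup x k : Delta_infty x -> spread x k <= M.
Proof.
by move=> xD; apply: sup_upper_bound; [exact: spread_has_sup|exists x => //; exists k].
Qed.

(** The constant is 4 for the tail of the sums, plus 1 for the distance of a nearly
optimal point to the supremum. *)
Lemma farthest_exists : exists2 z, Delta_infty z &
  forall k, M - 5 * 2^-1 ^+ k <= spread z k.
Proof.
have /choice[x xP] (j : nat) : exists x : family,
    Delta_infty x /\ forall k, M - 2^-1 ^+ j - 4 * 2^-1 ^+ k <= spread x k.
  have e0 : 0 < 2^-1 ^+ j :> R by rewrite exprn_gt0 // invr_gt0.
  have [_ [x xD [l _ <-]] xl] := sup_adherent e0 spread_has_sup.
  exists x; split=> // k; rewrite lerBlDr.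
  by apply: le_trans (ltW xl) _; exact: spread_tail.
have [|U [UU _]] := @exists_tail_ultrafilter setT; first by move=> k; exists k.
have UP : ProperFilter U := @ultra_proper _ _ UU.1.
have [|z zD zl] := @ultralimit_Delta R U UU S (fun n => x n n).
  by apply: nearW => n; apply: flowD; case: (xP n).
have xz m (e : gedge (S m)) : (fun n => x n m e) @ U --> z m e.
  apply: cvg_trans (zl m e); apply: near_eq_cvg; have := near_ge UU m.
  apply: filterS => n mn; congr (fun_of_fin _ _).
  by have [/Delta_inftyP[_ ->]] := xP n.
exists z => // k.
have sl : (fun n => spread (x n) k) @ U --> spread z k.
  apply: (cvg_sumr UU) => i _; apply: cvgMr.
  by apply: ultralimit_sqdist => // e; exact: xz.
apply: cvgr_to_ge sl _; have := near_ge UU k; apply: filterS => n kn.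
have [_ /(_ k)] := xP n; apply: le_trans.
have : 2^-1 ^+ n <= 2^-1 ^+ k :> R.
  by apply: ler_wiXn2l => //; rewrite ?invr_ge0 // invf_le1 // ler1n.
by lra.
Qed.

(** If [z] is a proper convex combination of [u] and [w], then the strict convexity
of the squared distance and the maximality of [z] bound the distance of [u] and
[w] at level [n] by the error terms of [farthest_exists], which tend to 0.  If
[z] is [y], then the supremum is 0 and all points are equal to [y]. *)
Lemma farthest_extreme : exists2 z, extreme z &
  (forall n, z n = y n) -> forall x, Delta_infty x -> forall n, x n = y n.
Proof.
have [z zD zM] := farthest_exists.
have small (c : R) m : (forall k, (m < k)%N -> c <= 5 * 2^-1 ^+ k) -> c <= 0.
  move=> cP; rewrite leNgt; apply/negP => c0.
  have [k kc] : exists k : nat, 2^-1 ^+ k < c / 5.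
    by apply: exp_half_small; rewrite divr_gt0.
  have : 5 * 2^-1 ^+ (k + m.+1) <= 5 * 2^-1 ^+ k :> R.
    rewrite ler_pM2l // ler_wiXn2l ?invr_ge0 // ?invf_le1 ?ler1n //.
    exact: leq_addr.
  by have := cP (k + m.+1)%N (leq_addl _ _); lra.
exists z.
  split=> // t u w /andP[t0 t1] uD wD zE.
  suff uw n : u n = w n by move=> n; rewrite zE -uw -scalerDl addrC subrK scale1r.
  apply: sqdist_eq0; have tt : 0 < t * (1 - t) * 2^-1 ^+ n.
    by rewrite !mulr_gt0 ?subr_gt0 ?exprn_gt0 ?invr_gt0.
  rewrite -(pmulr_rle0 _ tt); apply: (small _ n) => k nk.
  have := zM k; rewrite (spread_convex k zE) (bigD1 (Ordinal nk)) //=.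
  set r := \sum_(i < k | _) _.
  have r0 : 0 <= r by apply: sumr_ge0 => i _; rewrite mulr_ge0 ?half_ge0 ?sqdist_ge0.
  have := spread_le_sup k uD; have := spread_le_sup k wD.
  move: (spread u k) (spread w k) (2^-1 ^+ n) (sqdist _ _) (2^-1 ^+ k) => a b c d e *.
  have h1 : t * a <= t * M by rewrite ler_pM2l.
  have h2 : (1 - t) * b <= (1 - t) * M by rewrite ler_pM2l // subr_gt0.
  have h3 : 0 <= t * (1 - t) * r by rewrite !mulr_ge0 // ?subr_ge0 ltW.
  lra.
move=> zy x xD n; apply: sqdist_eq0.
have n0 : 0 < 2^-1 ^+ n :> R by rewrite exprn_gt0 ?invr_gt0.
rewrite -(pmulr_rle0 _ n0); apply: (small _ n) => k nk.
have := zM k; have -> : spread z k = 0.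
  rewrite /spread big1 // => i _; rewrite zy /sqdist big1 ?mulr0 // => e _.
  by rewrite subrr expr0n.
have := spread_le_sup k xD; rewrite /spread (bigD1 (Ordinal nk)) //=.
set r := \sum_(i < k | _) _.
have r0 : 0 <= r by apply: sumr_ge0 => i _; rewrite mulr_ge0 ?half_ge0 ?sqdist_ge0.
lra.
Qed.

End Farthest.

(** * Circuits expressing an extreme point *)

Section CircuitsNearExtreme.
Variables (R : realType) (S : coverSeq).
Variables (N : set nat) (C : forall n, {set {set gedge (S n)}}).
Hypothesis CN : circuit_system N C.
Variable z : forall n, {ffun gedge (S n) -> R}.
Hypothesis zext : extreme z.
Hypothesis zC : forall n, N n -> exists s : {set gedge (S n)} -> R,
  (forall c, c \in C n -> 0 <= s c) /\
  z n = \sum_(c in C n) s c *: circuit_tilde R c.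
Let zD : Delta_infty z := zext.1.
Let zflow n : flow_polytope (z n).
Proof. by have [/(_ n)] := zD. Qed.

Local Notation circ_xi n m c := (xito m (@circuit_tilde R (S n) c)).

Lemma weights_exist : exists s : forall n, {set gedge (S n)} -> R, forall n, N n ->
  [/\ forall c, c \in C n -> 0 <= s n c, \sum_(c in C n) s n c = 1 &
      forall m, (m <= n)%N -> forall e,
        z m e = \sum_(c in C n) s n c * circ_xi n m c e].
Proof.
have /dependent_choice[s sP] : forall n, exists s : {set gedge (S n)} -> R, N n ->
    (forall c, c \in C n -> 0 <= s c) /\
    z n = \sum_(c in C n) s c *: circuit_tilde R c.
  move=> n; have [/zC[s sP]|Nn] := pselect (N n); first by exists s.
  by exists (fun=> 0).
exists s => n Nn; have [s0 zE] := sP n Nn; split=> //.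
  by apply: sum_weights (CN Nn) (zflow n) zE.
move=> m mn e; have /Delta_inftyP[_ /(_ n m mn) <-] := zD.
by rewrite zE linear_sum sum_ffunE; apply: eq_bigr => c _; rewrite linearZ ffunE.
Qed.

(** With p the coordinate [e] of the projection of a circuit and z_e the one of [z],
the weights [s] have total mass 1 and average z_e for p.  So the weights
s (1 + p - z_e) also have total mass 1; they define flows [u n] at most twice
[z n].  Their limit is dominated by a multiple of [z], so it is [z] by
extremality, and its coordinate [e], the limit of z_e plus the variance of p
under [s], is z_e. *)
Lemma variance_ultralimit U (s : forall n, {set gedge (S n)} -> R) m (e : gedge (S m)) :
  tail_ultrafilter U -> U N ->
  (forall n, N n ->
    [/\ forall c, c \in C n -> 0 <= s n c, \sum_(c in C n) s n c = 1 &
        forall m, (m <= n)%N -> forall e,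
          z m e = \sum_(c in C n) s n c * circ_xi n m c e]) ->
  (fun n => \sum_(c in C n) s n c * (circ_xi n m c e - z m e) ^+ 2) @ U --> (0 : R).
Proof.
move=> UU UN sP; have UP : ProperFilter U := @ultra_proper _ _ UU.1.
pose q n c := 1 + circ_xi n m c e - z m e.
pose u n := \sum_(c in C n) (s n c * q n c) *: circuit_tilde R c.
have ct_flow n c : N n -> c \in C n -> flow_polytope (@circuit_tilde R _ c).
  by move=> /CN CC cC; apply: circuit_tilde_flow; exact: (fintype.subsetP CC).
have q02 n c : N n -> (m <= n)%N -> c \in C n -> 0 <= q n c <= 2.
  move=> Nn mn cC; have /andP[p0 p1] := flow_le1 e (xito_flow mn (ct_flow n c Nn cC)).
  have /andP[z0 z1] := flow_le1 e (zflow m).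
  by rewrite /q; apply/andP; split; lra.
have Nm : U [set n | N n /\ (m <= n)%N] by apply: filterI => //; exact: near_ge.
have [|y yD yl] := @ultralimit_Delta R U UU S u.
  apply: filterS Nm => n [Nn mn]; have [s0 s1 zE] := sP n Nn.
  apply: flow_convex => [c cC||c cC].
  - by rewrite mulr_ge0 ?s0 //; case/andP: (q02 n c Nn mn cC).
  - rewrite /q; under eq_bigr do rewrite -addrA mulrDr mulr1 mulrBr.
    by rewrite big_split sumrB /= -zE // -big_distrl /= s1 mul1r subrr addr0.
  - exact: ct_flow.
have yz : forall n, y n = z n.
  apply: (extreme_dominated (t := 2^-1) zext yD) => [|k e'].
    by apply/andP; split; lra.
  rewrite mulrC ler_pdivrMr //; apply: cvgr_to_le (yl k e') _.
  apply: (filterS _ (filterI Nm (near_ge UU k))) => n [[Nn mn] /= kn].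
  have [s0 s1 zE] := sP n Nn.
  rewrite (zE k kn) linear_sum sum_ffunE big_distrl /=; apply: ler_sum => c cC.
  rewrite linearZ ffunE /GRing.scale /= -!mulrA ler_wpM2l ?s0 // mulrC ler_wpM2l //.
    by have [+ _ _] := xito_flow kn (ct_flow n c Nn cC); apply.
  by case/andP: (q02 n c Nn mn cC).
have uz : (fun n => xito m (u n) e - z m e) @ U --> (0 : R).
  have ul : (fun n => xito m (u n) e) @ U --> z m e by rewrite -yz; exact: yl.
  by rewrite -(subrr (z m e)); apply: cvgB ul (cvg_cst _).
apply: cvg_trans uz; apply: near_eq_cvg; apply: filterS Nm => n [Nn mn].
have [s0 s1 zE] := sP n Nn; rewrite linear_sum sum_ffunE /=.
pose p c := circ_xi n m c e.
(* s (1 + p - z_e) p = s p + s (p - z_e)^2 + z_e s p - s z_e^2. *)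
transitivity (\sum_(c in C n) (s n c * p c + s n c * (p c - z m e) ^+ 2 +
    z m e * (s n c * p c) - s n c * z m e ^+ 2) - z m e).
  congr (_ - _); apply: eq_bigr => c _; rewrite linearZ ffunE /= -/(p c) /GRing.scale /=.
  by rewrite /q -/(p c); ring.
rewrite sumrB !big_split /= -big_distrr -big_distrl /= -zE // s1; ring.
Qed.

(** Otherwise the variances of [variance_ultralimit], summed over the coordinates of
the first [k] levels, stay above [eps] along some ultrafilter. *)
Lemma circuits_near_extreme k eps : 0 < eps -> exists n0 : nat, forall n,
  N n -> (n0 <= n)%N -> exists2 c, c \in C n &
    \sum_(m < k) sqdist (circ_xi n m c) (z m) < eps.
Proof.
move=> eps0; apply: contrapT => noc.
pose bad := [set n | N n /\ forall c, c \in C n ->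
   eps <= \sum_(m < k) sqdist (circ_xi n m c) (z m)].
have [|U [UU Ubad]] := @exists_tail_ultrafilter bad.
  move=> n0; apply: contrapT => nobad; apply: noc; exists n0 => n Nn n0n.
  apply: contrapT => noc; apply: nobad; exists n => //; split=> // c cC.
  by rewrite leNgt; apply/negP => cz; apply: noc; exists c.
have UP : ProperFilter U := @ultra_proper _ _ UU.1.
have UN : U N by apply: filterS Ubad => n [].
have [s sP] := weights_exist.
have : (fun n => \sum_(m < k) \sum_e \sum_(c in C n)
     s n c * (circ_xi n m c e - z m e) ^+ 2) @ U --> \sum_(m < k) \sum_(e : gedge (S m)) (0 : R).
  apply: (cvg_sumr UU) => m _; apply: (cvg_sumr UU) => e _.
  exact: variance_ultralimit.
under eq_bigr do rewrite sumr_const mul0rn.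
rewrite big1 // => V0; suff : eps <= 0 by rewrite leNgt eps0.
apply: cvgr_to_ge V0 _; apply: filterS Ubad => n [Nn nbad].
have [s0 s1 _] := sP n Nn; rewrite -[eps]mul1r -s1 big_distrl /=.
under [leRHS]eq_bigr do rewrite exchange_big /=.
rewrite [leRHS]exchange_big /=; apply: ler_sum => c cC.
apply: le_trans (ler_wpM2l (s0 c cC) (nbad c cC)) _.
by rewrite big_distrr; apply: ler_sum => m _; rewrite /sqdist big_distrr.
Qed.

(** A diagonal choice: in level [n], take a circuit that is [2^-l]-close to [z] on
the first [l] levels, for the largest possible [l <= n].  For every [k] and all
large [n], some circuit is good for [k], so that [l] is at least [k]. *)
Lemma extreme_limit_circuits :
  exists c : forall n, {set gedge (S n)}, (forall n, N n -> c n \in C n) /\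
    limit_along N (fun n => circuit_tilde R (c n)) z.
Proof.
have [s sP] := weights_exist.
have Cn0 n : N n -> exists c, c \in C n.
  move=> /sP[_ s1 _]; apply/set0Pn; apply: contra_eq_neq s1 => ->.
  by rewrite big_set0 eq_sym oner_eq0.
pose good n k (c : {set gedge (S n)}) := c \in C n /\
  \sum_(m < k) sqdist (circ_xi n m c) (z m) < 2^-1 ^+ k.
have half k : 0 < 2^-1 ^+ k :> R by rewrite exprn_gt0 ?invr_gt0.
have /dependent_choice[c cP] : forall n, exists c : {set gedge (S n)}, N n ->
    c \in C n /\ forall k, (k <= n)%N -> (exists c', good n k c') ->
      exists2 l, (k <= l)%N & good n l c.
  move=> n; have [Nn|] := pselect (N n); last by exists finset.set0.
  have [c0 c0C] := Cn0 n Nn.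
  pose p k := (k <= n)%N && `[< exists c', good n k c' >].
  have p0 : exists k, p k.
    exists 0%N; apply/asboolP; exists c0; split=> //.
    by rewrite big_ord0.
  have [l /andP[ln /asboolP[c lc]] lmax] := ex_maxnP p0 (fun k kp => (andP kp).1).
  exists c => _; split=> [|k kn kc]; first by case: lc.
  by exists l => //; apply: lmax; rewrite /p kn; apply/asboolP.
exists c; split=> [n /cP[]//|]; apply/limit_alongP => m eps eps0.
have [j jeps] := exp_half_small (exprn_gt0 2 eps0).
pose k := (j + m.+1)%N.
have [n0 n0P] := circuits_near_extreme k (half k).
exists (maxn n0 k) => n Nn mn; rewrite geq_max => /andP[n0n kn].
have [_ /(_ k kn)[|l kl [_ lc]]] := cP n Nn.
  by have [c' c'C c'z] := n0P n Nn n0n; exists c'.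
rewrite eucl_dist_lt //.
have ml : (m < l)%N by apply: leq_trans kl; rewrite /k leq_addl.
apply: lt_trans (le_lt_trans _ jeps).
  apply: le_lt_trans lc; rewrite (bigD1 (Ordinal ml)) //= lerDl.
  by apply: sumr_ge0 => i _; exact: sqdist_ge0.
apply: ler_wiXn2l; rewrite ?invr_ge0 ?invf_le1 ?ler1n //.
by apply: leq_trans kl; rewrite /k leq_addr.
Qed.

End CircuitsNearExtreme.

Lemma extreme_in_limit_circuits (R : realType) (S : coverSeq) (N : set nat)
    (C : forall n, {set {set gedge (S n)}}) (z : forall n, {ffun gedge (S n) -> R}) :
  circuit_system N C -> expresses_ergodic R N C -> extreme z ->
  limit_circuits R N C z.
Proof.
move=> CN CE zext; have [mu muinv muz] := Delta_infty_measure zext.1.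
have muE : measure_vec mu = z by apply/functional_extensionality_dep.
have zC : expresses N C mu by apply: CE; apply: extreme_ergodic; rewrite ?muE.
split; first exact: zext.1.
by apply: (extreme_limit_circuits CN zext) => n /zC; rewrite muz.
Qed.

(** * Unique ergodicity *)

Section UniqueErgodicity.
Variables (R : realType) (S : coverSeq).
Local Notation family := (forall n, {ffun gedge (S n) -> R}).

Lemma uniquely_ergodicP : uniquely_ergodic R S <->
  exists2 z : family, Delta_infty z & forall x, Delta_infty x -> x = z.
Proof.
split=> [[mu [muinv muU]]|[z zD zU]].
  exists (measure_vec mu); first exact: measure_vec_Delta.
  move=> x /Delta_infty_measure[nu /muU numu nux].
  apply/functional_extensionality_dep => n; rewrite -nux; apply/ffunP => e.
  rewrite !ffunE numu //.
  exact: measurable_edge_cylinder.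
have [mu muinv muz] := Delta_infty_measure zD; exists mu; split=> // nu nuinv.
apply: measure_vec_inj => n.
by rewrite muz (zU _ (measure_vec_Delta nuinv)).
Qed.

(** Circuits whose projections stay away from [z m] in arbitrarily high levels would
have a limit along an ultrafilter that is a second point of [Delta_infty]. *)
Lemma circuits_uniform_limit (z : family) m eps : Delta_infty z ->
  (forall x, Delta_infty x -> x = z) -> 0 < eps ->
  exists2 n0 : nat, (m < n0)%N & forall n, (n0 <= n)%N -> forall c, c \in Circ (S n) ->
    eucl_dist (xito m (circuit_tilde R c)) (z m) < eps.
Proof.
move=> zD zU eps0; apply: contrapT => nolim.
pose bad n (c : {set gedge (S n)}) := c \in Circ (S n) /\
  eps ^+ 2 <= sqdist (xito m (circuit_tilde R c)) (z m).
have [|U [UU Ubad]] := @exists_tail_ultrafilter [set n | exists c, bad n c].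
  move=> k; apply: contrapT => nobad; apply: nolim.
  exists (maxn k m.+1); first exact: leq_maxr.
  move=> n; rewrite geq_max => /andP[kn _] c cC; rewrite eucl_dist_lt //.
  rewrite ltNge; apply/negP => cz; apply: nobad; exists n => //.
  by exists c.
have UP : ProperFilter U := @ultra_proper _ _ UU.1.
have /dependent_choice[c cP] : forall n, exists c : {set gedge (S n)},
    (exists c, bad n c) -> bad n c.
  by move=> n; have [[c cb]|nb] := pselect (exists c, bad n c); [exists c|exists finset.set0].
have [|y /zU -> yl] := @ultralimit_Delta R U UU S (fun n => circuit_tilde R (c n)).
  by apply: filterS Ubad => n /cP[? _]; exact: circuit_tilde_flow.
have dl : (fun n => sqdist (xito m (circuit_tilde R (c n))) (z m)) @ U --> sqdist (z m) (z m).
  exact: ultralimit_sqdist.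
have : eps ^+ 2 <= sqdist (z m) (z m).
  by apply: cvgr_to_ge dl _; apply: filterS Ubad => n /cP[].
rewrite leNgt /sqdist big1 ?exprn_gt0 // => e _.
by rewrite subrr expr0n.
Qed.

Lemma ler_eucl_dist (G : graph) (a b : {ffun gedge G -> R}) e :
  `|a e - b e| <= eucl_dist a b.
Proof.
rewrite -sqrtr_sqr ler_wsqrtr // (bigD1 e) //= lerDl.
by apply: sumr_ge0 => e' _; exact: sqr_ge0.
Qed.

(** The flow of high level above [x m] is a convex combination of normalised
circuits, whose projections are all close to [nu]. *)
Lemma flow_uniform_limit m (nu : {ffun gedge (S m) -> R}) :
  (forall eps : R, 0 < eps -> exists2 n0 : nat, (m < n0)%N &
    forall n, (n0 <= n)%N -> forall c, c \in Circ (S n) ->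
      eucl_dist (xito m (circuit_tilde R c)) nu < eps) ->
  forall x, Delta_infty x -> x m = nu.
Proof.
move=> nuP x /Delta_inftyP[xf xxi]; apply/ffunP => e; apply/eqP.
rewrite -subr_eq0 -normr_le0; apply/ler_addgt0Pl => eps eps0; rewrite addr0.
have [n mn nP] := nuP eps eps0.
have [s [s0 xE]] := flow_decomposition (xf n).
have s1 := sum_weights (fintype.subxx _) (xf n) xE.
rewrite -(xxi n m (ltnW mn)) xE linear_sum sum_ffunE /=.
have -> : nu e = \sum_(c in Circ (S n)) s c * nu e by rewrite -big_distrl /= s1 mul1r.
rewrite -sumrB -[eps]mul1r -s1 big_distrl /=.
apply: le_trans (ler_norm_sum _ _ _) _; apply: ler_sum => c cC.
rewrite linearZ ffunE /GRing.scale /= -mulrBr normrM ger0_norm // ler_wpM2l //.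
by apply: le_trans (ler_eucl_dist _ _ _) _; apply: ltW; apply: nP.
Qed.

End UniqueErgodicity.

Theorem corollary4p24 (R : realType) (S : coverSeq) :
  [<-> uniquely_ergodic R S;
       forall (N : set nat) (C : forall n, {set {set gedge (S n)}}),
         infinite_set N -> circuit_system N C -> expresses_ergodic R N C ->
         exists y, limit_circuits R N C = [set y];
       exists (N : set nat) (C : forall n, {set {set gedge (S n)}}),
         [/\ infinite_set N, circuit_system N C, expresses_ergodic R N C &
             exists y, limit_circuits R N C = [set y]];
       forall m : nat, exists nu : {ffun gedge (S m) -> R},
         flow_polytope nu /\
         forall eps : R, 0 < eps -> exists n0 : nat, (m < n0)%N /\
           forall k : nat, (n0 <= k + m)%N ->
             forall c : {set gedge (S (k + m)%N)}, c \in Circ (S (k + m)%N) ->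
               eucl_dist (xi S k m (circuit_tilde R c)) nu < eps].
Proof.
tfae.
- move=> /uniquely_ergodicP[z zD zU] N C _ CN CE; exists z.
  have zext : extreme z by split=> // t u w _ /zU ->.
  by apply/seteqP; split=> [x [/zU //]|_ ->]; exact: extreme_in_limit_circuits.
- move=> H; exists setT, (fun n => Circ (S n)).
  have CN : circuit_system setT (fun n => Circ (S n)) by move=> n _.
  have CE : expresses_ergodic R setT (fun n => Circ (S n)).
    move=> mu [muinv _] n _.
    have [/(_ n) /flow_decomposition[s [s0 sE]] _] := measure_vec_Delta muinv.
    by exists s; split=> // c _; exact: s0.
  split=> //; first exact: infinite_nat.
  by apply: H => //; exact: infinite_nat.
- move=> [N [C [_ CN CE [y yE]]]] m.
  have [yD _] : limit_circuits R N C y by rewrite yE.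
  have [z zext zfar] := farthest_extreme yD.
  (* [y] is the only limit of circuits, so the extreme point [z] is [y]; being
     farthest from [y], it leaves no other point. *)
  have zy : z = y.
    by have := extreme_in_limit_circuits CN CE zext; rewrite yE.
  have yU x : Delta_infty x -> x = y.
    move=> xD; apply/functional_extensionality_dep => n.
    by apply: zfar xD n => k; rewrite zy.
  exists (y m); split; first by have [/(_ m)] := yD.
  move=> eps eps0; have [n0 mn0 n0P] := circuits_uniform_limit m yD yU eps0.
  by exists n0; split=> // k n0k c cC; rewrite xiE n0P.
- move=> H; apply/uniquely_ergodicP.
  have /dependent_choice[nu nuP] : forall m, exists nu : {ffun gedge (S m) -> R},
      forall eps : R, 0 < eps -> exists2 n0 : nat, (m < n0)%N &
      forall n, (n0 <= n)%N -> forall c, c \in Circ (S n) ->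
      eucl_dist (xito m (circuit_tilde R c)) nu < eps.
    move=> m; have [nu [_ nuP]] := H m; exists nu => eps /nuP[n0 [mn0 n0P]].
    exists n0 => // n n0n.
    have {}n0P k : (n0 <= k + m)%N -> forall c, c \in Circ (S (k + m)%N) ->
        eucl_dist (xito m (circuit_tilde R c)) nu < eps.
      by move=> n0k c cC; rewrite -xiE n0P.
    by have := n0P (n - m)%N; rewrite subnK ?(leq_trans (ltnW mn0)) //; apply.
  have nuE x : Delta_infty x -> x = nu.
    move=> xD; apply/functional_extensionality_dep => m.
    exact: flow_uniform_limit (nuP m) x xD.
  (* Any limit of circuits shows that [Delta_infty] is not empty. *)
  have [x xD] : exists x : forall n, {ffun gedge (S n) -> R}, Delta_infty x.
    have /dependent_choice[c cC] : forall n, exists c, c \in Circ (S n).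
      move=> n; have [x _] := inverse_limit_nonempty S.
      exact: exists_circuit (lcoord x n).
    have [|U [UU _]] := @exists_tail_ultrafilter setT; first by move=> k; exists k.
    have UP : ProperFilter U := @ultra_proper _ _ UU.1.
    have [|y yD _] := @ultralimit_Delta R U UU S (fun n => circuit_tilde R (c n)).
      by apply: nearW => n; apply: circuit_tilde_flow; exact: cC.
    by exists y.
  by exists nu => //; rewrite -(nuE x).
Qed.
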